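(* Let $p>1$, $h>0$, $\kappa\in\{-1,1\}$, $\sigma\in\mathbb{R}$, and set $\lambda=-\kappa h^{-1}-i\sigma$ and $$A(\lambda)=\frac{e^{-i\pi/4}\sqrt2\,\Gamma(\frac34-\frac12 i\lambda)}{\Gamma(\frac14-\frac12 i\lambda)}.$$ If $\kappa=1$, then for each $0<h<\infty$ there exists a unique $\sigma(h)\in(0,1)$ such that $A(\lambda)$ is real and positive, and thus there is a corresponding (nontrivial) outgoing solution $\varphi_{h,1,\sigma(h)}$. If $\kappa=-1$, then for each $h>0$ and each $0<\sigma<1$, $A(\lambda)$ is not real and positive, and thus there are no (nontrivial) outgoing solutions $\varphi_{h,-1,\sigma}$.
   Context: Let $D_\nu(z)$ denote the standard parabolic cylinder (Weber) function: for $\Re\nu<0$, $D_\nu(z)=\frac{e^{-z^2/4}}{\Gamma(-\nu)}\int_0^\infty e^{-zt}e^{-t^2/2}t^{-\nu-1}\,dt$, extended analytically to all $\nu\in\mathbb{C}$; it solves $\gamma''+(\nu+\frac12-\frac14z^2)\gamma=0$. Define $w(z,\lambda)=D_{i\lambda-\frac12}(e^{-i\pi/4}h^{1/2}z)$, which solves $-w_{zz}-\frac14h^2z^2w=h\lambda w$. Consider the equation $$(\kappa+ih\sigma)\varphi-\varphi_{zz}-\tfrac14h^2z^2\varphi-\delta|\varphi|^{p-1}\varphi=0,$$ where $\delta$ is the Dirac delta at $0$; it means the equation without the $\delta$ term holds for $z\ne0$, $\varphi$ is continuous at $0$, and $\varphi_z(0+)-\varphi_z(0-)=-|\varphi(0)|^{p-1}\varphi(0)$.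 A solution $\varphi$ of this equation is called outgoing if there are constants $\alpha_\pm\in\mathbb{C}$ with $\varphi(z)=\alpha_+w(z,\lambda)$ for $z>0$ and $\varphi(z)=\alpha_-w(-z,\lambda)$ for $z<0$, where $\lambda=-\kappa h^{-1}-i\sigma$. $\varphi_{h,\kappa,\sigma}$ denotes a nontrivial outgoing solution for the parameters $h,\kappa,\sigma$. *)

(* Defs.v *)
From Stdlib Require Import Reals ZArith.
From Coquelicot Require Import Coquelicot.
Open Scope R_scope.

Definition Ci : C := (0, 1).

Definition cexp (z : C) : C :=
  (exp (Re z) * cos (Im z), exp (Re z) * sin (Im z)).

Definition cpowR (t : R) (z : C) : C := cexp (z * RtoC (ln t)).

Definition CInt0inf (f : R -> C) : C :=
  @RInt_gen C_R_CompleteNormedModule f (at_right 0) (Rbar_locally p_infty).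

(* Euler's integral, valid for Re z > 0 *)
Definition Gamma_int (z : C) : C :=
  CInt0inf (fun t => cpowR t (z - 1) * RtoC (exp (- t)))%C.

(* meromorphic continuation of Gamma by Gamma(z) = Gamma(z+1)/z *)
Fixpoint Gamma_fuel (n : nat) (z : C) : C :=
  if Rlt_dec 0 (Re z) then Gamma_int z
  else match n with
       | O => 0%C
       | S m => (Gamma_fuel m (z + 1) / z)%C
       end.

Definition CGamma (z : C) : C :=
  Gamma_fuel (S (Z.to_nat (up (- Re z)))) z.

(* parabolic cylinder function, integral representation for Re nu < 0 *)
Definition D_int (nu z : C) : C :=
  (cexp (- (z * z) / 4) / CGamma (- nu) *
   CInt0inf (fun t => cexp (- z * RtoC t) * RtoC (exp (- t ^ 2 / 2))
                       * cpowR t (- nu - 1)))%C.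

(* analytic continuation to all nu via the (standard) recurrence
   D_{nu+1}(z) - z D_nu(z) + nu D_{nu-1}(z) = 0,
   i.e. D_nu(z) = z D_{nu-1}(z) - (nu-1) D_{nu-2}(z). *)
Fixpoint D_fuel (n : nat) (nu z : C) : C :=
  if Rlt_dec (Re nu) 0 then D_int nu z
  else match n with
       | O => 0%C
       | S m => (z * D_fuel m (nu - 1) z - (nu - 1) * D_fuel m (nu - 2) z)%C
       end.

Definition PCD (nu z : C) : C := D_fuel (S (Z.to_nat (up (Re nu)))) nu z.

Definition w_fun (h : R) (lam : C) (z : R) : C :=
  PCD (Ci * lam - RtoC (1 / 2))%C
      (cexp (- (Ci * RtoC (PI / 4))) * RtoC (sqrt h) * RtoC z)%C.

Definition lam_of (h kappa sigma : R) : C :=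
  (RtoC (- (kappa / h)) - Ci * RtoC sigma)%C.

Definition A_fun (lam : C) : C :=
  (cexp (- (Ci * RtoC (PI / 4))) * RtoC (sqrt 2)
   * CGamma (RtoC (3 / 4) - Ci * lam / 2)
   / CGamma (RtoC (1 / 4) - Ci * lam / 2))%C.

Definition real_pos (a : C) : Prop := Im a = 0 /\ 0 < Re a.

(* phi is an outgoing solution of
   (kappa + i h sigma) phi - phi_zz - h^2 z^2/4 phi - delta |phi|^{p-1} phi = 0 *)
Definition outgoing_solution (p h kappa sigma : R) (phi : R -> C) : Prop :=
  (exists phi1 phi2 : R -> C,
     forall z, z <> 0 ->
       @is_derive R_AbsRing C_R_NormedModule phi z (phi1 z) /\
       @is_derive R_AbsRing C_R_NormedModule phi1 z (phi2 z) /\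
       ((RtoC kappa + Ci * RtoC (h * sigma)) * phi z - phi2 z
        - RtoC (h ^ 2 * z ^ 2 / 4) * phi z)%C = 0%C) /\
  filterlim phi (locally 0) (locally (phi 0)) /\
  (exists dp dm : C,
     filterlim (fun t => (phi t - phi 0) / RtoC t)%C (at_right 0) (locally dp) /\
     filterlim (fun t => (phi t - phi 0) / RtoC t)%C (at_left 0) (locally dm) /\
     (dp - dm)%C = (- (RtoC (Rpower (Cmod (phi 0)) (p - 1)) * phi 0))%C) /\
  (exists ap am : C,
     (forall z, 0 < z -> phi z = (ap * w_fun h (lam_of h kappa sigma) z)%C) /\
     (forall z, z < 0 -> phi z = (am * w_fun h (lam_of h kappa sigma) (- z))%C)).

Definition nontrivial (phi : R -> C) : Prop := exists z, phi z <> 0%C.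

(* Main.v *)
(** Since [w(0) <> 0], continuity makes an outgoing solution even, and with
    [w'(0) = - sqrt h A(lambda) w(0)] the jump condition reads
    [2 sqrt h A(lambda) = |phi(0)|^(p-1)]: it is solvable iff [A(lambda)] is real and positive.

    Put [s = 1/4 - sigma/2] and [y = kappa/(2h)], so that
    [A = e^{-i pi/4} sqrt 2 Gamma(s+1/2+iy) / Gamma(s+iy)].  For [y > 0] the functional equation
    and [Gamma(n+x+iy) ~ n^{iy} Gamma(n+x)] give the argument of the Gamma quotient as
    [theta(s) = sum_j (atan((s+j+1/2)/y) - atan((s+j)/y))].  Each term decreases in [s >= -1/4],
    and [theta(s) + theta(s+1/2)] telescopes to [pi/2 - atan(s/y)]; this yields strict
    monotonicity, continuity, [0 < theta < pi] and [theta(-1/4) > pi/4].  The remaining bound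
    [theta(1/4) < pi/4] is the case [sigma = 0], where the equation is real and the flux
    [Im(w' conj w)] is constant: an outgoing solution carries positive flux, that is [Im A < 0].
    Hence [theta = pi/4] has exactly one solution.  For [kappa = -1] the argument of [A] is
    [- theta - pi/4], which lies in [(-5 pi/4, -pi/4)]. *)

Require Import Defs.
From Stdlib Require Import Reals ZArith Lra Lia.
From Coquelicot Require Import Coquelicot.
Open Scope R_scope.

(** Why the flux is needed: monotonicity and the relation between [theta(s)] and [theta(s+1/2)] only
    place [theta(1/4)] within [atan(1/(4y))/2] of [pi/4], on an unknown side, so the sign must come
    from the differential equation. For [sigma = 0] the energy [|w'|^2 - (1 - h^2 x^2/4) |w|^2] is
    nondecreasing on [x >= 0]. Write [w] as a phase of modulus one times a slowly varying factor
    [f]: the Weber integral gives [f' = O(1/x)], and a nonpositive flux forces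
    [(h x/2) |f| <= |f'|]. The energy would then be [O(1/x^2)], hence nonpositive everywhere, which
    is impossible where the potential is repulsive. No asymptotic expansion of parabolic cylinder
    functions enters.

    Gamma and Weber facts are read off from the integrals on [(0, infinity)]. No limit is exchanged
    with an integral: derivatives in a parameter and the growth of Gamma are both explicit
    inequalities between integrands, integrated against [t^{x-1} e^{-t}]. *)

Local Notation CV := C_R_CompleteNormedModule.
Local Notation CN := C_R_NormedModule.
Local Notation is_CInt f l := (@is_RInt_gen CV f (at_right 0) (Rbar_locally p_infty) l).
Local Notation is_RInt0 f l := (is_RInt_gen f (at_right 0) (Rbar_locally p_infty) l).

(** * Complex functions of a real variable and improper integrals *)

Lemma norm_Cmod (z : C) : @norm R_AbsRing CN z = Cmod z.
Proof.
unfold norm; simpl; unfold prod_norm, Cmod, norm; simpl; unfold abs; simpl.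
f_equal; rewrite !Rmult_1_r; unfold Rabs; destruct (Rcase_abs _), (Rcase_abs _); ring.
Qed.

Lemma scal_RtoC (k : R) (z : C) : @scal R_AbsRing CN k z = (RtoC k * z)%C.
Proof.
apply injective_projections; simpl; unfold scal; simpl; unfold mult; simpl; ring.
Qed.

Lemma filterlim_Cmod {T} (F : (T -> Prop) -> Prop) {FF : Filter F} (f : T -> C) (l : C) :
  filterlim f F (locally l) <->
  forall eps, 0 < eps -> F (fun t => Cmod (f t - l) < eps).
Proof.
split.
- intros H eps He.
  pose proof (proj1 (@filterlim_locally_ball_norm R_AbsRing T CN F FF f l) H (mkposreal eps He)) as H1.
  revert H1; apply filter_imp; intros t; unfold ball_norm; rewrite norm_Cmod; simpl; auto.
- intros H.
  apply (proj2 (@filterlim_locally_ball_norm R_AbsRing T CN F FF f l)).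
  intros [eps He]; generalize (H eps He); apply filter_imp; intros t.
  unfold ball_norm; rewrite norm_Cmod; simpl; auto.
Qed.

Lemma is_derive_C_intro (f : R -> C) (x : R) (l : C) :
  is_derive (fun t => fst (f t)) x (fst l) ->
  is_derive (fun t => snd (f t)) x (snd l) ->
  @is_derive R_AbsRing CN f x l.
Proof.
intros H1 H2.
assert (E : forall z : C, z = plus (scal (fst z) (1, 0) : CN) (scal (snd z) (0, 1) : CN)).
{ intros z; rewrite !scal_RtoC; apply injective_projections; simpl; unfold plus; simpl; ring. }
rewrite (E l).
apply (is_derive_ext (fun t => plus (scal (fst (f t)) (1, 0) : CN) (scal (snd (f t)) (0, 1) : CN))).
- intros t; symmetry; apply E.
- apply (@is_derive_plus R_AbsRing CN);
    now apply (@is_derive_scal_l R_AbsRing CN).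
Qed.

Lemma is_derive_C_fst (f : R -> C) (x : R) (l : C) :
  @is_derive R_AbsRing CN f x l -> is_derive (fun t => fst (f t)) x (fst l).
Proof.
intros H.
eapply filterdiff_ext_lin.
- apply (@filterdiff_comp R_AbsRing R_NormedModule CN R_NormedModule _ _ f (fun z : C => fst z) (fun y => scal y l) (fun z : C => fst z) H).
  apply filterdiff_linear, (@is_linear_fst R_AbsRing R_NormedModule R_NormedModule).
- intros y; reflexivity.
Qed.

Lemma is_derive_C_snd (f : R -> C) (x : R) (l : C) :
  @is_derive R_AbsRing CN f x l -> is_derive (fun t => snd (f t)) x (snd l).
Proof.
intros H.
eapply filterdiff_ext_lin.
- apply (@filterdiff_comp R_AbsRing R_NormedModule CN R_NormedModule _ _ f (fun z : C => snd z) (fun y => scal y l) (fun z : C => snd z) H).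
  apply filterdiff_linear, (@is_linear_snd R_AbsRing R_NormedModule R_NormedModule).
- intros y; reflexivity.
Qed.

Lemma is_derive_R_plus (f g : R -> R) (x a b : R) :
  is_derive f x a -> is_derive g x b -> is_derive (fun t => f t + g t) x (a + b).
Proof. intros; now apply (@is_derive_plus R_AbsRing R_NormedModule). Qed.

Lemma is_derive_R_minus (f g : R -> R) (x a b : R) :
  is_derive f x a -> is_derive g x b -> is_derive (fun t => f t - g t) x (a - b).
Proof. intros; now apply (@is_derive_minus R_AbsRing R_NormedModule). Qed.

Lemma is_derive_R_mult (f g : R -> R) (x a b : R) :
  is_derive f x a -> is_derive g x b -> is_derive (fun t => f t * g t) x (a * g x + f x * b).
Proof. intros; apply (is_derive_mult f g x); auto; intros; apply Rmult_comm. Qed.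

Lemma is_derive_C_mult (f g : R -> C) (x : R) (a b : C) :
  @is_derive R_AbsRing CN f x a -> @is_derive R_AbsRing CN g x b ->
  @is_derive R_AbsRing CN (fun t => f t * g t)%C x (a * g x + f x * b)%C.
Proof.
intros Hf Hg.
pose proof (is_derive_C_fst _ _ _ Hf) as Hf1; pose proof (is_derive_C_snd _ _ _ Hf) as Hf2.
pose proof (is_derive_C_fst _ _ _ Hg) as Hg1; pose proof (is_derive_C_snd _ _ _ Hg) as Hg2.
apply is_derive_C_intro; simpl.
- replace (fst a * fst (g x) - snd a * snd (g x) + (fst (f x) * fst b - snd (f x) * snd b))
    with ((fst a * fst (g x) + fst (f x) * fst b) - (snd a * snd (g x) + snd (f x) * snd b)) by ring.
  apply is_derive_R_minus; now apply is_derive_R_mult.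
- replace (fst a * snd (g x) + snd a * fst (g x) + (fst (f x) * snd b + snd (f x) * fst b))
    with ((fst a * snd (g x) + fst (f x) * snd b) + (snd a * fst (g x) + snd (f x) * fst b)) by ring.
  apply is_derive_R_plus; now apply is_derive_R_mult.
Qed.

Lemma is_derive_C_plus (f g : R -> C) (x : R) (a b : C) :
  @is_derive R_AbsRing CN f x a -> @is_derive R_AbsRing CN g x b ->
  @is_derive R_AbsRing CN (fun t => f t + g t)%C x (a + b)%C.
Proof. intros; now apply (@is_derive_plus R_AbsRing CN). Qed.

Lemma is_derive_C_const (c : C) (x : R) : @is_derive R_AbsRing CN (fun _ => c) x (RtoC 0).
Proof. apply (@is_derive_const R_AbsRing CN). Qed.

Lemma is_derive_C_scal (c : C) (f : R -> C) (x : R) (a : C) :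
  @is_derive R_AbsRing CN f x a -> @is_derive R_AbsRing CN (fun t => c * f t)%C x (c * a)%C.
Proof.
intros H; replace (c * a)%C with (0 * f x + c * a)%C by ring.
apply is_derive_C_mult; auto; apply is_derive_C_const.
Qed.

Lemma is_derive_RtoC (f : R -> R) (x a : R) :
  is_derive f x a -> @is_derive R_AbsRing CN (fun t => RtoC (f t)) x (RtoC a).
Proof.
intros H; apply is_derive_C_intro; simpl; auto.
apply (@is_derive_const R_AbsRing R_NormedModule).
Qed.

Lemma is_derive_exp_comp (u : R -> R) (x a : R) :
  is_derive u x a -> is_derive (fun t => exp (u t)) x (a * exp (u x)).
Proof. intros H; apply (is_derive_comp exp u); auto; apply is_derive_exp. Qed.

Lemma is_derive_cexp (u : R -> C) (x : R) (a : C) :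
  @is_derive R_AbsRing CN u x a ->
  @is_derive R_AbsRing CN (fun t => cexp (u t)) x (a * cexp (u x))%C.
Proof.
intros H.
pose proof (is_derive_C_fst _ _ _ H) as H1; pose proof (is_derive_C_snd _ _ _ H) as H2.
assert (Hc : is_derive (fun t => cos (snd (u t))) x (snd a * - sin (snd (u x)))).
{ apply (is_derive_comp cos (fun t => snd (u t))); auto; apply is_derive_cos. }
assert (Hs : is_derive (fun t => sin (snd (u t))) x (snd a * cos (snd (u x)))).
{ apply (is_derive_comp sin (fun t => snd (u t))); auto; apply is_derive_sin. }
pose proof (is_derive_exp_comp _ _ _ H1) as He.
apply is_derive_C_intro; unfold cexp, Re, Im; simpl.
- replace (_ - _) with (fst a * exp (fst (u x)) * cos (snd (u x)) + exp (fst (u x)) * (snd a * - sin (snd (u x)))) by ring.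
  apply (is_derive_R_mult (fun t => exp (fst (u t))) (fun t => cos (snd (u t)))); auto.
- replace (fst a * _ + _) with (fst a * exp (fst (u x)) * sin (snd (u x)) + exp (fst (u x)) * (snd a * cos (snd (u x)))) by ring.
  apply (is_derive_R_mult (fun t => exp (fst (u t))) (fun t => sin (snd (u t)))); auto.
Qed.

Lemma is_derive_cpowR (z : C) (t : R) : 0 < t ->
  @is_derive R_AbsRing CN (fun t => cpowR t z) t (z * RtoC (/ t) * cpowR t z)%C.
Proof.
intros Ht; apply (is_derive_cexp (fun t => z * RtoC (ln t))%C).
apply is_derive_C_scal, is_derive_RtoC, is_derive_ln; auto.
Qed.

Lemma is_derive_C_continuous (f : R -> C) (x : R) (a : C) :
  @is_derive R_AbsRing CN f x a -> @continuous R_UniformSpace CN f x.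
Proof. intros H; apply (@ex_derive_continuous R_AbsRing CN); now exists a. Qed.

Lemma cexp_plus (z w : C) : cexp (z + w) = (cexp z * cexp w)%C.
Proof.
unfold cexp, Re, Im; apply injective_projections; simpl;
  rewrite exp_plus, ?cos_plus, ?sin_plus; ring.
Qed.

Lemma cexp_0 : cexp 0 = 1%C.
Proof. unfold cexp; simpl; rewrite exp_0, cos_0, sin_0; apply injective_projections; simpl; ring. Qed.

Lemma Cmod_cexp (z : C) : Cmod (cexp z) = exp (Re z).
Proof.
unfold Cmod, cexp; simpl.
replace (_ + _) with ((exp (Re z) * exp (Re z)) * (Rsqr (sin (Im z)) + Rsqr (cos (Im z)))) by (unfold Rsqr; ring).
rewrite sin2_cos2, Rmult_1_r; apply sqrt_square; left; apply exp_pos.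
Qed.

Lemma cexp_neq_0 (z : C) : cexp z <> 0%C.
Proof. apply Cmod_gt_0; rewrite Cmod_cexp; apply exp_pos. Qed.

Lemma cexp_RtoC (x : R) : cexp (RtoC x) = RtoC (exp x).
Proof. unfold cexp; simpl; rewrite cos_0, sin_0; apply injective_projections; simpl; ring. Qed.

Lemma cpowR_plus (t : R) (z w : C) : cpowR t (z + w) = (cpowR t z * cpowR t w)%C.
Proof. unfold cpowR; rewrite <- cexp_plus; f_equal; ring. Qed.

Lemma Cmod_cpowR (t : R) (z : C) : Cmod (cpowR t z) = Rpower t (Re z).
Proof. unfold cpowR, Rpower; rewrite Cmod_cexp; f_equal; unfold Re; simpl; ring. Qed.

Lemma cpowR_RtoC (t x : R) : cpowR t (RtoC x) = RtoC (Rpower t x).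
Proof.
unfold cpowR, Rpower; rewrite <- cexp_RtoC; f_equal.
apply injective_projections; simpl; ring.
Qed.

Lemma cpowR_1 (t : R) : 0 < t -> cpowR t 1 = RtoC t.
Proof. intros Ht; rewrite (cpowR_RtoC t 1), Rpower_1; auto. Qed.

Lemma filter_0 : Filter (at_right 0).
Proof. apply at_right_proper_filter. Qed.

Lemma filter_infty : Filter (Rbar_locally p_infty).
Proof. apply Rbar_locally_filter. Qed.

Lemma filter_prod_0_infty (P : R * R -> Prop) :
  (forall a b, 0 < a -> a < b -> P (a, b)) ->
  filter_prod (at_right 0) (Rbar_locally p_infty) P.
Proof.
intros H.
apply (Filter_prod _ _ _ (fun a => 0 < a < 1) (fun b => 1 < b)).
- exists (mkposreal 1 Rlt_0_1); intros a Ha H0; split; auto.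
  revert Ha; unfold ball; simpl; unfold AbsRing_ball, abs, minus, plus, opp; simpl.
  intros Ha; apply Rabs_lt_between in Ha; lra.
- now exists 1.
- intros a b Ha Hb; apply H; lra.
Qed.

Section ImproperIntegral.
Context {V : CompleteNormedModule R_AbsRing}.

Lemma is_RInt_gen_antiderivative (F f : R -> V) (l0 l1 : V) :
  (forall t, 0 < t -> is_derive F t (f t)) ->
  (forall t, 0 < t -> continuous f t) ->
  filterlim F (at_right 0) (locally l0) ->
  filterlim F (Rbar_locally p_infty) (locally l1) ->
  is_RInt_gen f (at_right 0) (Rbar_locally p_infty) (minus l1 l0).
Proof.
intros HF Hf H0 H1.
apply (filterlimi_lim_ext_loc (fun ab => minus (F (snd ab)) (F (fst ab)))).
- apply filter_prod_0_infty; simpl; intros a b Ha Hb.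
  apply is_RInt_derive; intros t; rewrite Rmin_left by lra; intros; [apply HF | apply Hf]; lra.
- unfold minus.
  apply (filterlim_comp_2 (fun ab : R * R => F (snd ab)) (fun ab => opp (F (fst ab))) plus
           (G := locally l1) (H := locally (opp l0))).
  + eapply filterlim_comp; [ apply filterlim_snd | exact H1 ].
  + eapply filterlim_comp; [ eapply filterlim_comp; [ apply filterlim_fst | exact H0 ] | apply (@filterlim_opp R_AbsRing V) ].
  + apply (@filterlim_plus R_AbsRing V).
Qed.

(** Comparison test through an explicit antiderivative [G] of the majorant: increments of the
    integral of [f] are at most those of [G], so the Cauchy property at both ends passes from [G] to
    [f]. *)
Lemma ex_RInt_gen_dominated (f : R -> V) (G g : R -> R) (l0 l1 : R) :
  (forall t, 0 < t -> continuous f t) ->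
  (forall t, 0 < t -> is_derive G t (g t)) ->
  (forall t, 0 < t -> continuous g t) ->
  (forall t, 0 < t -> norm (f t) <= g t) ->
  filterlim G (at_right 0) (locally l0) ->
  filterlim G (Rbar_locally p_infty) (locally l1) ->
  ex_RInt_gen f (at_right 0) (Rbar_locally p_infty).
Proof.
intros Hf HG Hg Hfg H0 H1.
pose (F := RInt f 1).
assert (Hex : forall a b, 0 < a -> 0 < b -> ex_RInt f a b).
{ intros a b Ha Hb; apply (ex_RInt_continuous f).
  intros t Ht; apply Hf; destruct Ht as [Ht _].
  eapply Rlt_le_trans; [ | exact Ht]; apply Rmin_glb_lt; auto. }
assert (HF : forall t, 0 < t -> is_derive F t (f t)).
{ intros t Ht; apply (is_derive_RInt f F 1 t); auto.
  exists (mkposreal t Ht); intros u Hu; apply (RInt_correct f), Hex; try lra.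
  revert Hu; unfold ball; simpl; unfold AbsRing_ball, abs, minus, plus, opp; simpl.
  intros Hu; apply Rabs_lt_between in Hu; lra. }
assert (Hle : forall a b, 0 < a -> a <= b -> norm (minus (F b) (F a)) <= G b - G a).
{ intros a b Ha Hb.
  apply (norm_RInt_le f g a b); auto.
  - intros t Ht; apply Hfg; lra.
  - apply is_RInt_derive; intros t; rewrite Rmin_left by lra; intros; [apply HF | apply Hf]; lra.
  - apply (is_RInt_derive G g); intros t; rewrite Rmin_left by lra; intros; [apply HG | apply Hg]; lra. }
assert (Hab : forall a b, 0 < a -> 0 < b -> norm (minus (F b) (F a)) <= Rabs (G b - G a)).
{ intros a b Ha Hb; destruct (Rle_lt_dec a b).
  - eapply Rle_trans; [ apply Hle; auto | apply Rle_abs].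
  - rewrite <- norm_opp, opp_minus, Rabs_minus_sym.
    eapply Rle_trans; [ apply Hle; lra | apply Rle_abs]. }
assert (Hlim : forall (FF : (R -> Prop) -> Prop) (l : R), ProperFilter FF -> FF (fun t => 0 < t) ->
   filterlim G FF (locally l) -> exists L, filterlim F FF (locally L)).
{ intros FF l HFF Hpos HGl.
  apply (proj1 (@filterlim_locally_cauchy R V FF HFF F)).
  intros eps.
  pose (d := mkposreal (eps / 2) (is_pos_div_2 eps)).
  exists (fun t => 0 < t /\ ball l d (G t)); split.
  - apply filter_and; auto; apply HGl; apply locally_ball.
  - intros u v [Hu Hu'] [Hv Hv'].
    apply (norm_compat1 (F u) (F v)).
    eapply Rle_lt_trans; [ apply Hab; auto | ].
    revert Hu' Hv'; unfold d, ball; simpl; unfold AbsRing_ball, abs, minus, plus, opp; simpl.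
    intros Hu' Hv'; apply Rabs_lt_between in Hu'; apply Rabs_lt_between in Hv'.
    apply Rabs_lt_between; lra. }
destruct (Hlim (at_right 0) l0) as [L0 HL0]; auto.
{ apply at_right_proper_filter. }
{ exists (mkposreal 1 Rlt_0_1); auto. }
destruct (Hlim (Rbar_locally p_infty) l1) as [L1 HL1]; auto.
{ apply Rbar_locally_filter. }
{ exists 0; auto. }
exists (minus L1 L0); apply (is_RInt_gen_antiderivative F f); auto.
Qed.

End ImproperIntegral.

Lemma exp_le_compat (x y : R) : x <= y -> exp x <= exp y.
Proof. intros [H | ->]; [left; now apply exp_increasing | apply Rle_refl]. Qed.

(** The right side is the maximum of the left one, attained at [t = x]; it follows from
    [ln (t/x) <= t/x - 1]. *)
Lemma Rpower_exp_bound (x t : R) : 0 < x -> 0 < t ->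
  Rpower t x * exp (- t) <= exp (x * ln x - x).
Proof.
intros Hx Ht; unfold Rpower; rewrite <- exp_plus; apply exp_le_compat.
assert (Ht' : 0 < t / x) by (apply Rdiv_lt_0_compat; auto).
assert (H : ln (t / x) <= t / x - 1).
{ pose proof (exp_ineq1_le (ln (t / x))) as H; rewrite exp_ln in H; auto; lra. }
rewrite ln_div in H by auto.
apply (Rmult_le_compat_l x) in H; [ | lra].
replace (x * (t / x - 1)) with (t - x) in H by (field; lra); lra.
Qed.

(** The universal majorant: every complex integrand of the proof is bounded by a multiple of it, and
    its moments are values of Gamma. *)
Definition gamma_dom (x t : R) : R := Rpower t (x - 1) * exp (- t).

Lemma gamma_dom_pos (x t : R) : 0 < gamma_dom x t.
Proof. apply Rmult_lt_0_compat; apply exp_pos. Qed.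

Lemma gamma_dom_S (x t : R) : 0 < t -> gamma_dom (x + 1) t = t * gamma_dom x t.
Proof.
intros Ht; unfold gamma_dom; replace (x + 1 - 1) with (x - 1 + 1) by ring.
rewrite Rpower_plus, Rpower_1; auto; ring.
Qed.

(** The exponential is traded for a power because [t^{x-1} (1+t)^{-x-1}] has the elementary
    antiderivative [(t/(1+t))^x / x], as [ex_RInt_gen_dominated] requires. *)
Lemma gamma_dom_le (x t : R) : 0 < x -> 0 < t ->
  gamma_dom x t <= exp ((x + 1) * ln (x + 1) - (x + 1) + 1) *
                   (Rpower t (x - 1) * Rpower (1 + t) (- x - 1)).
Proof.
intros Hx Ht.
pose proof (Rpower_exp_bound (x + 1) (1 + t)) as H.
replace (exp (- (1 + t))) with (exp (-1) * exp (- t)) in H by (rewrite <- exp_plus; f_equal; ring).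
unfold gamma_dom.
rewrite exp_plus.
replace (- x - 1) with (- (x + 1)) by ring; rewrite Rpower_Ropp.
assert (Hp : 0 < Rpower (1 + t) (x + 1)) by apply exp_pos.
assert (He : exp 1 * exp (-1) = 1) by (rewrite <- exp_plus; replace (1 + -1) with 0 by ring; apply exp_0).
assert (H' : exp (- t) <= exp ((x + 1) * ln (x + 1) - (x + 1)) * exp 1 * / Rpower (1 + t) (x + 1)).
{ apply (Rmult_le_reg_r (Rpower (1 + t) (x + 1) * exp (-1))).
  - apply Rmult_lt_0_compat; auto; apply exp_pos.
  - eapply Rle_trans; [ | eapply Rle_trans; [apply H; lra | ]].
    + right; ring.
    + right. transitivity (exp ((x + 1) * ln (x + 1) - (x + 1)) * (exp 1 * exp (-1))).
      * rewrite He; ring.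
      * field; lra. }
assert (Hq : 0 < Rpower t (x - 1)) by apply exp_pos.
apply (Rmult_le_compat_l (Rpower t (x - 1))) in H'; [ | lra].
eapply Rle_trans; [ exact H' | right; ring].
Qed.

Lemma filterlim_Rpower_0 (x eps : R) : 0 < x -> 0 < eps -> at_right 0 (fun t => Rpower t x < eps).
Proof.
intros Hx He.
exists (mkposreal (Rpower eps (/ x)) (exp_pos _)); intros t Ht H0.
revert Ht; unfold ball; simpl; unfold AbsRing_ball, abs, minus, plus, opp; simpl; intros Ht.
apply Rabs_lt_between in Ht.
replace eps with (Rpower (Rpower eps (/ x)) x).
- apply Rlt_Rpower_l; lra.
- rewrite Rpower_mult, Rinv_l, Rpower_1; lra.
Qed.

Lemma ex_RInt_gen_gamma_dom {V : CompleteNormedModule R_AbsRing} (f : R -> V) (x K : R) :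
  0 < x ->
  (forall t, 0 < t -> continuous f t) ->
  (forall t, 0 < t -> norm (f t) <= K * gamma_dom x t) ->
  ex_RInt_gen f (at_right 0) (Rbar_locally p_infty).
Proof.
intros Hx Hf Hb.
assert (HK : 0 <= K).
{ pose proof (Hb 1 Rlt_0_1) as H; pose proof (norm_ge_0 (f 1)) as H'.
  pose proof (gamma_dom_pos x 1) as H''.
  apply Rnot_lt_le; intros HK; nra. }
set (M := K * exp ((x + 1) * ln (x + 1) - (x + 1) + 1)).
(* The antiderivative is [(M/x) (t/(1+t))^x], which runs from 0 to [M/x]. *)
apply (ex_RInt_gen_dominated f (fun t => M / x * exp (x * (ln t - ln (1 + t))))
  (fun t => M * (exp ((x - 1) * ln t) * exp ((- x - 1) * ln (1 + t)))) 0 (M / x)); auto.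
- intros t Ht; evar_last.
  + auto_derive; [ repeat split; lra | reflexivity ].
  + rewrite <- exp_plus.
    replace ((x - 1) * ln t + (- x - 1) * ln (1 + t)) with
      (x * (ln t + - ln (1 + t)) + (- ln t + - ln (1 + t))) by ring.
    rewrite !exp_plus, !exp_Ropp, !exp_ln by lra.
    field; lra.
- intros t Ht; apply (@ex_derive_continuous R_AbsRing R_NormedModule); auto_derive; repeat split; lra.
- intros t Ht; eapply Rle_trans; [apply Hb; auto | ].
  unfold M; rewrite Rmult_assoc; apply Rmult_le_compat_l; auto.
  apply gamma_dom_le; auto.
- apply filterlim_locally; intros eps.
  assert (HM : 0 <= M / x).
  { apply Rmult_le_pos; [apply Rmult_le_pos; auto; left; apply exp_pos | left; now apply Rinv_0_lt_compat]. }
  assert (He : 0 < eps / (M / x + 1)) by (apply Rdiv_lt_0_compat; [ apply eps | lra]).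
  assert (Hp : at_right 0 (fun t => 0 < t)) by (exists (mkposreal 1 Rlt_0_1); auto).
  generalize (filter_and _ _ Hp (filterlim_Rpower_0 x _ Hx He)); apply filter_imp.
  intros t [Ht Ht']; unfold ball; simpl; unfold AbsRing_ball, abs, minus, plus, opp; simpl.
  rewrite Ropp_0, Rplus_0_r, Rabs_pos_eq; [ | apply Rmult_le_pos; auto; left; apply exp_pos].
  apply Rle_lt_trans with (M / x * Rpower t x).
  + apply Rmult_le_compat_l; auto; apply exp_le_compat.
    assert (0 <= ln (1 + t)) by (rewrite <- ln_1; apply ln_le; lra). nra.
  + apply Rle_lt_trans with ((M / x) * (eps / (M / x + 1))).
    * apply Rmult_le_compat_l; auto; lra.
    * apply Rlt_le_trans with ((M / x + 1) * (eps / (M / x + 1))).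
      -- apply Rmult_lt_compat_r; lra.
      -- right; clear - HM; set (q := M / x) in *; field; lra.
(* In the variable [1/t] the limit at infinity becomes continuity at 0. *)
- apply (filterlim_ext_loc (fun t => M / x * exp (x * - ln (/ t + 1)))).
  { exists 1; intros t Ht; f_equal; f_equal; f_equal.
    replace (/ t + 1) with ((1 + t) / t) by (field; lra); rewrite ln_div; lra. }
  assert (E : M / x = M / x * exp (x * - ln (0 + 1))).
  { rewrite Rplus_0_l, ln_1, Ropp_0, Rmult_0_r, exp_0; ring. }
  apply (fun H => eq_ind_r (fun l => filterlim _ _ (locally l)) H E).
  apply (filterlim_comp _ _ _ (fun t => / t) (fun v => M / x * exp (x * - ln (v + 1))) _ (locally 0)).
  + apply (filterlim_Rbar_inv p_infty); discriminate.
  + apply (@ex_derive_continuous R_AbsRing R_NormedModule (fun v => M / x * exp (x * - ln (v + 1)))); auto_derive; repeat split; lra.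
Qed.

Lemma is_CInt_unique (f : R -> C) (l : C) : is_CInt f l -> CInt0inf f = l.
Proof. intros H; exact (@is_RInt_gen_unique CV _ _ (Proper_StrongProper _ (at_right_proper_filter 0))
  (Proper_StrongProper _ (Rbar_locally_filter p_infty)) f l H). Qed.

Lemma is_CInt_correct (f : R -> C) (x K : R) : 0 < x ->
  (forall t, 0 < t -> @continuous R_UniformSpace CN f t) ->
  (forall t, 0 < t -> Cmod (f t) <= K * gamma_dom x t) ->
  is_CInt f (CInt0inf f).
Proof.
intros Hx Hf Hb.
destruct (@ex_RInt_gen_gamma_dom CV f x K) as [l Hl]; auto.
- intros t Ht; rewrite norm_Cmod; auto.
- now rewrite (is_CInt_unique f l).
Qed.

Lemma is_CInt_ext (f g : R -> C) (l : C) :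
  (forall t, 0 < t -> f t = g t) -> is_CInt f l -> is_CInt g l.
Proof.
intros H; apply (@is_RInt_gen_ext CV _ _ filter_0 filter_infty).
apply filter_prod_0_infty; simpl; intros a b Ha Hb t; rewrite Rmin_left by lra; intros; apply H; lra.
Qed.

Lemma is_CInt_fst (f : R -> C) (l : C) : is_CInt f l ->
  is_RInt_gen (fun t => fst (f t)) (at_right 0) (Rbar_locally p_infty) (fst l).
Proof.
intros H P HP.
assert (HP' : @locally CN l (fun z => P (fst z))).
{ destruct HP as [eps HP]; exists eps; intros z [Hz _]; auto. }
generalize (H _ HP'); unfold filtermapi; apply filter_imp; intros [a b] [z [Hz Hz']].
exists (fst z); split; auto; simpl in *.
apply (@is_RInt_fct_extend_fst R_NormedModule R_NormedModule); auto.
Qed.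

Lemma is_CInt_snd (f : R -> C) (l : C) : is_CInt f l ->
  is_RInt_gen (fun t => snd (f t)) (at_right 0) (Rbar_locally p_infty) (snd l).
Proof.
intros H P HP.
assert (HP' : @locally CN l (fun z => P (snd z))).
{ destruct HP as [eps HP]; exists eps; intros z [_ Hz]; auto. }
generalize (H _ HP'); unfold filtermapi; apply filter_imp; intros [a b] [z [Hz Hz']].
exists (snd z); split; auto; simpl in *.
apply (@is_RInt_fct_extend_snd R_NormedModule R_NormedModule); auto.
Qed.

Lemma is_CInt_intro (f : R -> C) (l : C) :
  is_RInt_gen (fun t => fst (f t)) (at_right 0) (Rbar_locally p_infty) (fst l) ->
  is_RInt_gen (fun t => snd (f t)) (at_right 0) (Rbar_locally p_infty) (snd l) ->
  is_CInt f l.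
Proof.
intros H1 H2 P [eps HP].
pose proof (H1 _ (locally_ball (fst l) eps)) as G1; pose proof (H2 _ (locally_ball (snd l) eps)) as G2.
unfold filtermapi in *; generalize (filter_and _ _ G1 G2); apply filter_imp; intros [a b] [[u [Hu Hu']] [v [Hv Hv']]].
exists (u, v); split.
- apply (@is_RInt_fct_extend_pair R_NormedModule R_NormedModule); auto.
- apply HP; split; auto.
Qed.

Lemma is_CInt_plus (f g : R -> C) (l m : C) :
  is_CInt f l -> is_CInt g m -> is_CInt (fun t => f t + g t)%C (l + m)%C.
Proof. apply (@is_RInt_gen_plus CV _ _ filter_0 filter_infty). Qed.

Lemma is_CInt_scal (c : C) (f : R -> C) (l : C) :
  is_CInt f l -> is_CInt (fun t => c * f t)%C (c * l)%C.
Proof.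
intros H; pose proof (is_CInt_fst _ _ H) as H1; pose proof (is_CInt_snd _ _ H) as H2.
apply is_CInt_intro; simpl.
- apply (@is_RInt_gen_minus R_NormedModule _ _ filter_0 filter_infty);
  now apply (@is_RInt_gen_scal R_NormedModule _ _ filter_0 filter_infty).
- apply (@is_RInt_gen_plus R_NormedModule _ _ filter_0 filter_infty);
  now apply (@is_RInt_gen_scal R_NormedModule _ _ filter_0 filter_infty).
Qed.

Lemma Cmod_CInt_le (f : R -> C) (g : R -> R) (l : C) (m : R) :
  (forall t, 0 < t -> Cmod (f t) <= g t) ->
  is_CInt f l -> is_RInt_gen g (at_right 0) (Rbar_locally p_infty) m -> Cmod l <= m.
Proof.
intros H Hf Hg; rewrite <- norm_Cmod.
apply (@RInt_gen_norm CV _ _ (at_right_proper_filter 0) (Rbar_locally_filter p_infty) f g); auto.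
- apply filter_prod_0_infty; simpl; intros; lra.
- apply filter_prod_0_infty; simpl; intros a b Ha Hb t Ht; rewrite norm_Cmod; apply H; lra.
Qed.

(** Integration by parts without boundary terms: [F] is at most [K t^x e^{-t}], which vanishes at
    both ends. The recurrences of Gamma and of Weber's integral are instances. *)
Lemma is_CInt_derive_0 (F f : R -> C) (x K : R) : 0 < x ->
  (forall t, 0 < t -> @is_derive R_AbsRing CN F t (f t)) ->
  (forall t, 0 < t -> @continuous R_UniformSpace CN f t) ->
  (forall t, 0 < t -> Cmod (F t) <= K * gamma_dom (x + 1) t) ->
  is_CInt f (RtoC 0).
Proof.
intros Hx HF Hf Hb.
assert (HK : 0 <= K).
{ pose proof (Hb 1 Rlt_0_1) as H; pose proof (Cmod_ge_0 (F 1)) as H'.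
  pose proof (gamma_dom_pos (x + 1) 1) as H''.
  apply Rnot_lt_le; intros HK; nra. }
replace (RtoC 0) with (@minus CV (RtoC 0) (RtoC 0)) by apply (@minus_eq_zero CV).
apply (@is_RInt_gen_antiderivative CV F f); auto.
- apply (filterlim_Cmod _ (FF := filter_0)); intros eps He.
  assert (He' : 0 < eps / (K + 1)) by (apply Rdiv_lt_0_compat; lra).
  assert (Hp : at_right 0 (fun t => 0 < t)) by (exists (mkposreal 1 Rlt_0_1); auto).
  generalize (filter_and _ _ Hp (filterlim_Rpower_0 x _ Hx He')); apply filter_imp.
  intros t [Ht Ht'].
  replace (F t - 0)%C with (F t) by ring.
  eapply Rle_lt_trans; [apply Hb; auto | ].
  assert (exp (- t) <= 1) by (rewrite <- exp_0; apply exp_le_compat; lra).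
  assert (0 < exp (- t)) by apply exp_pos.
  assert (0 < Rpower t x) by apply exp_pos.
  unfold gamma_dom; replace (x + 1 - 1) with x by ring.
  apply Rle_lt_trans with (K * (eps / (K + 1))); [ apply Rmult_le_compat_l; auto; nra | ].
  apply Rlt_le_trans with ((K + 1) * (eps / (K + 1))); [ nra | right; field; lra].
- apply (filterlim_Cmod _ (FF := filter_infty)); intros eps He.
  set (M := exp ((x + 1) * ln (x + 1) - (x + 1))).
  assert (HM : 0 < M) by apply exp_pos.
  (* Since [t^{x+1} e^{-t} <= M], the bound on [F t] is at most [K M / t]. *)
  exists (K * M / eps); intros t Ht.
  assert (H0 : 0 <= K * M / eps) by (apply Rmult_le_pos; [nra | left; now apply Rinv_0_lt_compat]).
  assert (Ht0 : 0 < t) by lra.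
  replace (F t - 0)%C with (F t) by ring.
  eapply Rle_lt_trans; [apply Hb; auto | ].
  pose proof (Rpower_exp_bound (x + 1) t ltac:(lra) Ht0) as H; fold M in H.
  rewrite Rpower_plus, Rpower_1 in H by auto.
  unfold gamma_dom; replace (x + 1 - 1) with x by ring.
  apply (Rmult_lt_reg_r t); auto.
  apply Rle_lt_trans with (K * M); [ nra | ].
  apply (Rmult_lt_compat_r eps) in Ht; auto.
  replace (K * M / eps * eps) with (K * M) in Ht by (field; lra); lra.
Qed.

(** * Euler's integral *)

Lemma is_derive_C_eq (f : R -> C) (x : R) (a b : C) :
  @is_derive R_AbsRing CN f x a -> a = b -> @is_derive R_AbsRing CN f x b.
Proof. now intros H <-. Qed.

Definition gamma_integrand (z : C) (t : R) : C := (cpowR t (z - 1) * RtoC (exp (- t)))%C.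

Lemma is_derive_exp_opp (t : R) :
  @is_derive R_AbsRing CN (fun t => RtoC (exp (- t))) t (- RtoC (exp (- t)))%C.
Proof.
eapply is_derive_C_eq.
- apply (is_derive_RtoC (fun t => exp (- t)) t (- exp (- t))).
  auto_derive; auto; ring.
- apply injective_projections; simpl; ring.
Qed.

Lemma is_derive_gamma_integrand (z : C) (t : R) : 0 < t ->
  @is_derive R_AbsRing CN (gamma_integrand z) t
    ((z - 1) * RtoC (/ t) * cpowR t (z - 1) * RtoC (exp (- t))
     + cpowR t (z - 1) * - RtoC (exp (- t)))%C.
Proof.
intros Ht; apply (is_derive_C_mult (fun t => cpowR t (z - 1)) (fun t => RtoC (exp (- t)))).
- now apply is_derive_cpowR.
- apply is_derive_exp_opp.
Qed.

Lemma continuous_gamma_integrand (z : C) (t : R) : 0 < t ->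
  @continuous R_UniformSpace CN (gamma_integrand z) t.
Proof. intros Ht; eapply is_derive_C_continuous; now apply is_derive_gamma_integrand. Qed.

Lemma Cmod_gamma_integrand (z : C) (t : R) : Cmod (gamma_integrand z t) = gamma_dom (Re z) t.
Proof.
unfold gamma_integrand, gamma_dom; rewrite Cmod_mult, Cmod_cpowR, Cmod_R, Rabs_pos_eq.
- do 2 f_equal; simpl; ring.
- left; apply exp_pos.
Qed.

Lemma is_CInt_Gamma (z : C) : 0 < Re z -> is_CInt (gamma_integrand z) (Gamma_int z).
Proof.
intros Hz; apply (is_CInt_correct _ (Re z) 1); auto.
- intros; now apply continuous_gamma_integrand.
- intros; rewrite Cmod_gamma_integrand; lra.
Qed.

Lemma continuous_C_plus (f g : R -> C) (t : R) :
  @continuous R_UniformSpace CN f t -> @continuous R_UniformSpace CN g t ->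
  @continuous R_UniformSpace CN (fun t => f t + g t)%C t.
Proof. apply (@continuous_plus R_UniformSpace R_AbsRing CN). Qed.

(** The integral of the derivative of [t^z e^{-t}] vanishes. *)
Lemma Gamma_int_S (z : C) : 0 < Re z -> Gamma_int (z + 1) = (z * Gamma_int z)%C.
Proof.
intros Hz.
assert (H1 : is_CInt (fun t => z * gamma_integrand z t + (- (1)) * gamma_integrand (z + 1) t)%C
               (z * Gamma_int z + (- (1)) * Gamma_int (z + 1))%C).
{ apply is_CInt_plus; apply is_CInt_scal; apply is_CInt_Gamma; auto; unfold Re in *; simpl; lra. }
assert (H0 : is_CInt (fun t => z * gamma_integrand z t + (- (1)) * gamma_integrand (z + 1) t)%C (RtoC 0)).
{ apply (is_CInt_derive_0 (fun t => cpowR t z * RtoC (exp (- t)))%C _ (Re z) 1); auto.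
  - intros t Ht; eapply is_derive_C_eq.
    + apply (is_derive_C_mult (fun t => cpowR t z) (fun t => RtoC (exp (- t)))); [ now apply is_derive_cpowR | apply is_derive_exp_opp].
    + unfold gamma_integrand.
      replace (z + 1 - 1)%C with z by ring.
      replace (cpowR t z) with (cpowR t (z - 1) * RtoC t)%C.
      2:{ rewrite <- (cpowR_1 t) by auto; rewrite <- cpowR_plus; f_equal; ring. }
      rewrite RtoC_inv by lra; field; intros E; apply RtoC_inj in E; lra.
  - intros t Ht; apply (continuous_C_plus (fun t => z * gamma_integrand z t)%C (fun t => - (1) * gamma_integrand (z + 1) t)%C);
    eapply is_derive_C_continuous; apply is_derive_C_scal; now apply is_derive_gamma_integrand.
  - intros t Ht; rewrite Cmod_mult, Cmod_cpowR, Cmod_R, Rabs_pos_eq by (left; apply exp_pos).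
    unfold gamma_dom; right; replace (Re z + 1 - 1) with (Re z) by ring; ring. }
pose proof (is_CInt_unique _ _ H1) as E; rewrite (is_CInt_unique _ _ H0) in E.
replace (Gamma_int (z + 1)) with (z * Gamma_int z - (z * Gamma_int z + - (1) * Gamma_int (z + 1)))%C by ring.
rewrite <- E; ring.
Qed.

Definition rGamma (x : R) : R := Re (Gamma_int (RtoC x)).

Lemma gamma_integrand_RtoC (x t : R) : gamma_integrand (RtoC x) t = RtoC (gamma_dom x t).
Proof.
unfold gamma_integrand, gamma_dom.
rewrite RtoC_mult, <- (cpowR_RtoC t (x - 1)), RtoC_minus; reflexivity.
Qed.

Lemma is_RInt0_ext (f g : R -> R) (l : R) :
  (forall t, 0 < t -> f t = g t) -> is_RInt0 f l -> is_RInt0 g l.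
Proof.
intros H; apply (@is_RInt_gen_ext R_NormedModule _ _ filter_0 filter_infty).
apply filter_prod_0_infty; simpl; intros a b Ha Hb t; rewrite Rmin_left by lra; intros; apply H; lra.
Qed.

Lemma is_RInt0_unique (f : R -> R) (l m : R) : is_RInt0 f l -> is_RInt0 f m -> l = m.
Proof.
intros Hl Hm.
rewrite <- (@is_RInt_gen_unique R_CompleteNormedModule _ _ (Proper_StrongProper _ (at_right_proper_filter 0))
  (Proper_StrongProper _ (Rbar_locally_filter p_infty)) f l Hl).
exact (@is_RInt_gen_unique R_CompleteNormedModule _ _ (Proper_StrongProper _ (at_right_proper_filter 0))
  (Proper_StrongProper _ (Rbar_locally_filter p_infty)) f m Hm).
Qed.

Lemma is_RInt0_plus (f g : R -> R) (l m : R) :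
  is_RInt0 f l -> is_RInt0 g m -> is_RInt0 (fun t => f t + g t) (l + m).
Proof. apply (@is_RInt_gen_plus R_NormedModule _ _ filter_0 filter_infty). Qed.

Lemma is_RInt0_scal (c : R) (f : R -> R) (l : R) :
  is_RInt0 f l -> is_RInt0 (fun t => c * f t) (c * l).
Proof. apply (@is_RInt_gen_scal R_NormedModule _ _ filter_0 filter_infty). Qed.

Lemma is_RInt0_rGamma (x : R) : 0 < x -> is_RInt0 (gamma_dom x) (rGamma x).
Proof.
intros Hx; eapply is_RInt0_ext; [ | apply is_CInt_fst, is_CInt_Gamma; exact Hx].
intros t Ht; cbv beta; rewrite gamma_integrand_RtoC; reflexivity.
Qed.

Lemma Gamma_int_RtoC (x : R) : 0 < x -> Gamma_int (RtoC x) = RtoC (rGamma x).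
Proof.
intros Hx; apply injective_projections; [reflexivity | ]; change (snd (RtoC (rGamma x))) with 0.
apply (is_RInt0_unique (fun t => snd (gamma_integrand (RtoC x) t))).
- now apply is_CInt_snd, is_CInt_Gamma.
- apply (is_RInt0_ext (fun t => 0 * gamma_dom x t)).
  + intros; rewrite gamma_integrand_RtoC; simpl; ring.
  + replace 0 with (0 * rGamma x) at 2 by ring; now apply is_RInt0_scal, is_RInt0_rGamma.
Qed.

Lemma rGamma_S (x : R) : 0 < x -> rGamma (x + 1) = x * rGamma x.
Proof.
intros Hx; unfold rGamma at 1; rewrite RtoC_plus, Gamma_int_S by auto.
rewrite Gamma_int_RtoC by auto; unfold Re; simpl; ring.
Qed.

(* [(1 - e^{-t})^x] is an explicit antiderivative of a minorant of [x t^{x-1} e^{-t}]. *)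
Lemma rGamma_pos (x : R) : 1 <= x -> 0 < rGamma x.
Proof.
intros Hx.
set (f := fun t => x * exp ((x - 1) * ln (1 - exp (- t))) * exp (- t)).
assert (Hu : forall t, 0 < t -> 0 < 1 - exp (- t) <= t).
{ intros t Ht; split.
  - assert (exp (- t) < exp 0) by (apply exp_increasing; lra). rewrite exp_0 in *; lra.
  - pose proof (exp_ineq1_le (- t)); lra. }
assert (H : is_RInt0 f (1 - 0)).
{ apply (@is_RInt_gen_antiderivative R_CompleteNormedModule (fun t => exp (x * ln (1 - exp (- t)))) f 0 1).
  - intros t Ht; pose proof (Hu t Ht); evar_last.
    + auto_derive; [ lra | reflexivity ].
    + unfold f; change (1 + - exp (- t)) with (1 - exp (- t)).
      replace (x * ln (1 - exp (- t))) with ((x - 1) * ln (1 - exp (- t)) + ln (1 - exp (- t))) by ring.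
      rewrite exp_plus, exp_ln by lra; field; lra.
  - intros t Ht; pose proof (Hu t Ht).
    apply (@ex_derive_continuous R_AbsRing R_NormedModule); unfold f; auto_derive; lra.
  - apply filterlim_locally; intros eps.
    assert (Hp : at_right 0 (fun t => 0 < t)) by (exists (mkposreal 1 Rlt_0_1); auto).
    assert (Hx0 : 0 < x) by lra.
    generalize (filter_and _ _ Hp (filterlim_Rpower_0 x _ Hx0 (cond_pos eps))); apply filter_imp.
    intros t [Ht Ht']; unfold ball; simpl; unfold AbsRing_ball, abs, minus, plus, opp; simpl.
    rewrite Ropp_0, Rplus_0_r, Rabs_pos_eq; [ | left; apply exp_pos].
    eapply Rle_lt_trans; [ | exact Ht'].
    apply exp_le_compat, Rmult_le_compat_l; try lra.
    apply ln_le; apply Hu; auto.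
  - assert (E : 1 = exp (x * ln (1 - 0))) by (rewrite Rminus_0_r, ln_1, Rmult_0_r, exp_0; auto).
    apply (fun H => eq_ind_r (fun l => filterlim _ _ (locally l)) H E).
    apply (filterlim_comp _ _ _ (fun t => exp (- t)) (fun v => exp (x * ln (1 - v))) _ (locally 0)).
    + apply (filterlim_comp _ _ _ Ropp exp _ (Rbar_locally m_infty)).
      * apply (filterlim_Rbar_opp p_infty).
      * apply is_lim_exp_m.
    + apply (@ex_derive_continuous R_AbsRing R_NormedModule (fun v => exp (x * ln (1 - v)))); auto_derive; lra. }
assert (H1 : norm (1 - 0) <= x * rGamma x).
{ apply (@RInt_gen_norm R_CompleteNormedModule _ _ (at_right_proper_filter 0) (Rbar_locally_filter p_infty) f (fun t => x * gamma_dom x t)); auto.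
  - apply filter_prod_0_infty; simpl; intros; lra.
  - apply filter_prod_0_infty; simpl; intros a b Ha Hb t Ht.
    unfold norm, f; simpl; unfold abs; simpl.
    pose proof (exp_pos (- t)); pose proof (exp_pos ((x - 1) * ln (1 - exp (- t)))).
    rewrite Rabs_pos_eq by (apply Rmult_le_pos; [apply Rmult_le_pos | ]; lra).
    unfold gamma_dom; rewrite Rmult_assoc; apply Rmult_le_compat_l; try lra.
    apply Rmult_le_compat_r; try lra.
    apply exp_le_compat, Rmult_le_compat_l; try lra.
    apply ln_le; apply Hu; lra.
  - apply is_RInt0_scal, is_RInt0_rGamma; lra. }
revert H1; unfold norm; simpl; unfold abs; simpl; rewrite Rminus_0_r, Rabs_R1; intros H1; nra.
Qed.

Lemma Rabs_sin_le (u : R) : Rabs (sin u) <= Rabs u.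
Proof.
assert (Hp : forall v, 0 < v -> Rabs (sin v) <= v).
{ intros v Hv; apply Rabs_le; split.
  - destruct (Rle_lt_dec v PI).
    + pose proof (sin_ge_0 v ltac:(lra) ltac:(lra)); lra.
    + pose proof (SIN_bound v); pose proof PI2_1; lra.
  - left; now apply sin_lt_x. }
destruct (Rtotal_order u 0) as [H | [-> | H]].
- rewrite <- (Rabs_Ropp (sin u)), <- sin_neg, <- (Rabs_Ropp u), (Rabs_pos_eq (- u)) by lra.
  apply Hp; lra.
- rewrite sin_0; lra.
- rewrite (Rabs_pos_eq u) by lra; now apply Hp.
Qed.

(** The chord between two points of the unit circle has length [2 |sin ((a-b)/2)|]. *)
Lemma Cmod_cexp_Im_minus (a b : R) : Cmod (cexp (0, a) - cexp (0, b)) <= Rabs (a - b).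
Proof.
unfold Cmod, cexp, Re, Im; simpl; rewrite exp_0.
replace (_ + _) with (Rsqr (2 * sin ((a - b) / 2))).
- rewrite sqrt_Rsqr_abs, Rabs_mult, (Rabs_pos_eq 2) by lra.
  pose proof (Rabs_sin_le ((a - b) / 2)) as H.
  unfold Rdiv in H at 2; rewrite Rabs_mult, (Rabs_pos_eq (/ 2)) in H by lra; lra.
- set (u := (a - b) / 2).
  assert (E : cos (a - b) = 1 - 2 * sin u * sin u).
  { replace (a - b) with (2 * u) by (unfold u; field); apply cos_2a_sin. }
  rewrite cos_minus in E.
  pose proof (sin2_cos2 a) as Ha; pose proof (sin2_cos2 b) as Hb.
  unfold Rsqr in *; nra.
Qed.

(** With [p = sqrt u] the right side is [(2 (p - 1/p))^2]. A bound in [u] and [1/u] is wanted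
    because its integral against [gamma_dom] only involves neighbouring Gamma values. *)
Lemma ln_sqr_le (u : R) : 0 < u -> ln u * ln u <= 4 * (u - 2 + / u).
Proof.
intros Hu.
set (w := ln u); set (p := exp (w / 2)).
assert (Hp : 0 < p) by apply exp_pos.
assert (Hpp : p * p = u).
{ unfold p; rewrite <- exp_plus; replace (w / 2 + w / 2) with w by field; now apply exp_ln. }
assert (H1 : w <= 2 * (p - 1)) by (pose proof (exp_ineq1_le (w / 2)); unfold p; lra).
assert (H2 : - w <= 2 * (/ p - 1)).
{ pose proof (exp_ineq1_le (- (w / 2))) as H; rewrite exp_Ropp in H; fold p in H; lra. }
replace (4 * (u - 2 + / u)) with ((2 * (p - / p)) * (2 * (p - / p))) by (rewrite <- Hpp; field; lra).
assert (Hq : p * / p = 1) by (field; lra).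
assert (Hq0 : 0 < / p) by (apply Rinv_0_lt_compat; auto).
destruct (Rle_lt_dec 0 w).
- assert (1 <= p) by lra. assert (/ p <= 1) by nra.
  apply Rmult_le_compat; lra.
- assert (1 <= / p) by lra. assert (p <= 1) by nra.
  replace (2 * (p - / p) * (2 * (p - / p))) with ((2 * (/ p - p)) * (2 * (/ p - p))) by ring.
  replace (w * w) with ((- w) * (- w)) by ring.
  apply Rmult_le_compat; lra.
Qed.

(** The inequality of arithmetic and geometric means turns the bound on the square into one on
    [|ln u|] itself, avoiding a Cauchy-Schwarz inequality for integrals. *)
Lemma Rabs_ln_le (u eps : R) : 0 < u -> 0 < eps -> Rabs (ln u) <= eps + (u - 2 + / u) / eps.
Proof.
intros Hu He; pose proof (ln_sqr_le u Hu) as H.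
assert (Hw : Rabs (ln u) * Rabs (ln u) = ln u * ln u).
{ rewrite <- Rabs_mult; apply Rabs_pos_eq; nra. }
set (w := Rabs (ln u)) in *.
apply (Rmult_le_reg_r eps); auto.
replace ((eps + (u - 2 + / u) / eps) * eps) with (eps * eps + (u - 2 + / u)) by (field; lra).
assert (0 <= (w / 2 - eps) * (w / 2 - eps)) by apply Rle_0_sqr. nra.
Qed.

(** The weight [t^{m-1} e^{-t}] concentrates near [t = m], so for [n] close to [m] the phase
    [t^{iy}] may be replaced by [n^{iy}], at a cost of at most [|y| |ln (t/n)|]. Under this weight,
    the mean of [t/n] is [m/n] and that of [n/t] is [n/(m-1)], whence [1 < m]. *)
Lemma Gamma_int_asymp_bound (m n y eps : R) : 1 < m -> 0 < n -> 0 < eps ->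
  Cmod (Gamma_int (m, y) - cpowR n (0, y) * RtoC (rGamma m)) <=
  Rabs y * (eps + (m / n - 2 + n / (m - 1)) / eps) * rGamma m.
Proof.
intros Hm Hn He.
rewrite <- Gamma_int_RtoC by lra.
assert (Hf : is_CInt (fun t => gamma_integrand (m, y) t + (- cpowR n (0, y)) * gamma_integrand (RtoC m) t)%C
   (Gamma_int (m, y) + (- cpowR n (0, y)) * Gamma_int (RtoC m))%C).
{ apply is_CInt_plus; [ | apply is_CInt_scal]; apply is_CInt_Gamma; simpl; lra. }
replace (Gamma_int (m, y) - cpowR n (0, y) * Gamma_int (RtoC m))%C with
  (Gamma_int (m, y) + (- cpowR n (0, y)) * Gamma_int (RtoC m))%C by ring.
apply (Cmod_CInt_le _ (fun t => Rabs y * (eps - 2 / eps) * gamma_dom m t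
    + (Rabs y / (n * eps) * gamma_dom (m + 1) t + Rabs y * n / eps * gamma_dom (m - 1) t)) _ _) with (2 := Hf).
- intros t Ht.
  replace (gamma_integrand (m, y) t) with (cpowR t (0, y) * gamma_integrand (RtoC m) t)%C.
  2:{ unfold gamma_integrand; rewrite Cmult_assoc, <- cpowR_plus; f_equal; f_equal.
      apply injective_projections; simpl; ring. }
  replace (_ + _)%C with ((cpowR t (0, y) - cpowR n (0, y)) * gamma_integrand (RtoC m) t)%C by ring.
  rewrite Cmod_mult, Cmod_gamma_integrand; simpl.
  rewrite gamma_dom_S by auto.
  assert (E : gamma_dom (m - 1) t = gamma_dom m t * / t).
  { replace m with (m - 1 + 1) at 2 by ring; rewrite gamma_dom_S by auto; field; lra. }
  rewrite E.
  replace (_ + _) with ((Rabs y * (eps + (t / n - 2 + / (t / n)) / eps)) * gamma_dom m t)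
    by (field; repeat split; lra).
  apply Rmult_le_compat_r; [left; apply gamma_dom_pos | ].
  assert (Ec : forall s, cpowR s (0, y) = cexp (0, y * ln s)).
  { intros s; unfold cpowR; f_equal; apply injective_projections; simpl; ring. }
  rewrite !Ec.
  eapply Rle_trans; [ apply Cmod_cexp_Im_minus | ].
  replace (y * ln t - y * ln n) with (y * ln (t / n)) by (rewrite ln_div by auto; ring).
  rewrite Rabs_mult; apply Rmult_le_compat_l; [ apply Rabs_pos | ].
  apply Rabs_ln_le; auto; now apply Rdiv_lt_0_compat.
- replace (Rabs y * (eps + (m / n - 2 + n / (m - 1)) / eps) * rGamma m) with
    (Rabs y * (eps - 2 / eps) * rGamma m
      + (Rabs y / (n * eps) * rGamma (m + 1) + Rabs y * n / eps * rGamma (m - 1))).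
  + apply (is_RInt0_plus (fun t => Rabs y * (eps - 2 / eps) * gamma_dom m t)
      (fun t => Rabs y / (n * eps) * gamma_dom (m + 1) t + Rabs y * n / eps * gamma_dom (m - 1) t)).
    * apply is_RInt0_scal, is_RInt0_rGamma; lra.
    * apply (is_RInt0_plus (fun t => Rabs y / (n * eps) * gamma_dom (m + 1) t)
        (fun t => Rabs y * n / eps * gamma_dom (m - 1) t));
      apply is_RInt0_scal, is_RInt0_rGamma; lra.
  + rewrite rGamma_S by lra.
    replace (rGamma m) with ((m - 1) * rGamma (m - 1)).
    * field; repeat split; lra.
    * rewrite <- rGamma_S by lra; f_equal; ring.
Qed.

Lemma Gamma_int_asymp (x y eta : R) : 1 <= x -> 0 < eta ->
  exists N : nat, forall n : nat, (N <= n)%nat ->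
    Cmod (Gamma_int (INR (S n) + x, y) - cpowR (INR (S n)) (0, y) * RtoC (rGamma (INR (S n) + x)))
    <= eta * rGamma (INR (S n) + x).
Proof.
intros Hx He.
set (Y := Rabs y + 1); assert (HY : 0 < Y) by (pose proof (Rabs_pos y); unfold Y; lra).
(* Both terms of the bound will be at most [|y| eps]. Taking [Y = |y| + 1] keeps the division
   legitimate when [y = 0]. *)
set (eps := eta / (2 * Y)).
assert (Heps : 0 < eps) by (apply Rdiv_lt_0_compat; lra).
destruct (INR_unbounded (x / (eps * eps))) as [N HN]; exists N; intros n Hn.
assert (Hn0 : INR N < INR (S n)) by (apply lt_INR; lia).
assert (H1 : 0 < INR (S n)) by (apply lt_0_INR; lia).
set (nn := INR (S n)) in *.
eapply Rle_trans; [ apply (Gamma_int_asymp_bound _ _ _ eps); lra | ].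
apply Rmult_le_compat_r; [ left; apply rGamma_pos; lra | ].
assert (Hb : ((nn + x) / nn - 2 + nn / (nn + x - 1)) / eps <= eps).
{ apply (Rmult_le_reg_r eps); auto.
  replace (_ / eps * eps) with ((nn + x) / nn - 2 + nn / (nn + x - 1)) by (field; lra).
  (* For [m = n + x] the first-order terms cancel; as [1 <= x], at most [x/n] remains, and [N] was
     chosen to make it smaller than [eps^2]. *)
  replace (_ + _) with (x / nn - (x - 1) / (nn + x - 1)) by (field; lra).
  assert (0 <= (x - 1) / (nn + x - 1)).
  { apply Rmult_le_pos; [lra | left; apply Rinv_0_lt_compat; lra]. }
  assert (x / nn <= eps * eps); [ | lra].
  apply (Rmult_le_reg_r nn); auto.
  replace (x / nn * nn) with x by (field; lra).
  assert (Hlt : x / (eps * eps) < nn) by lra.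
  apply (Rmult_lt_compat_r (eps * eps)) in Hlt; [ | nra].
  replace (x / (eps * eps) * (eps * eps)) with x in Hlt by (field; lra); lra. }
apply Rle_trans with (Rabs y * (eps + eps)).
- apply Rmult_le_compat_l; [apply Rabs_pos | lra].
- apply Rle_trans with (Y * (eps + eps)); [ unfold Y; nra | ].
  unfold eps; right; field; lra.
Qed.

(** * The argument of the Gamma quotient *)

Lemma Cinv_neq_0 (z : C) : z <> 0%C -> (/ z)%C <> 0%C.
Proof.
intros Hz E; apply Hz; replace z with (z * z * / z)%C by (field; auto); rewrite E; ring.
Qed.

Definition cis (t : R) : C := cexp (0, t).

Lemma cis_0 : cis 0 = 1%C.
Proof. apply cexp_0. Qed.

Lemma cis_neq_0 (t : R) : cis t <> 0%C.
Proof. apply cexp_neq_0. Qed.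

Lemma cis_plus (s t : R) : cis (s + t) = (cis s * cis t)%C.
Proof. unfold cis; rewrite <- cexp_plus; f_equal; apply injective_projections; simpl; ring. Qed.

Lemma cis_opp (t : R) : cis (- t) = (/ cis t)%C.
Proof.
assert (H : (cis (- t) * cis t)%C = 1%C) by (rewrite <- cis_plus, Rplus_opp_l; apply cis_0).
replace (cis (- t)) with (cis (- t) * cis t / cis t)%C by (field; apply cis_neq_0).
rewrite H; field; apply cis_neq_0.
Qed.

(** A zero would propagate to all [z + n] by the functional equation, whereas far to the right Gamma
    has relative distance at most 1/2 from a number of modulus [rGamma > 0]. *)
Lemma Gamma_int_neq_0 (z : C) : 0 < Re z -> Gamma_int z <> 0%C.
Proof.
intros Hz Hz0.
assert (H : forall n, Gamma_int (z + RtoC (INR n)) = 0%C).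
{ induction n as [ | n IH].
  - rewrite <- Hz0; f_equal; simpl; ring.
  - rewrite S_INR, RtoC_plus, Cplus_assoc, Gamma_int_S, IH; [ring | ].
    unfold Re in *; simpl; pose proof (pos_INR n); lra. }
destruct (Gamma_int_asymp (Re z + 1) (Im z) (1 / 2)) as [N HN]; try lra.
specialize (HN N (le_n _)).
replace (INR (S N) + (Re z + 1), Im z) with (z + RtoC (INR (S (S N))))%C in HN.
2:{ rewrite (S_INR (S N)); apply injective_projections; unfold Re, Im; simpl; ring. }
rewrite H in HN.
set (r := rGamma (INR (S N) + (Re z + 1))) in *.
assert (Hr : 0 < r) by (apply rGamma_pos; pose proof (pos_INR (S N)); lra).
replace (0 - _)%C with (- (cpowR (INR (S N)) (0, Im z) * RtoC r))%C in HN by ring.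
rewrite Cmod_opp, Cmod_mult, Cmod_cpowR, Cmod_R, Rabs_pos_eq in HN by lra.
unfold Re, Rpower in HN; simpl fst in HN; rewrite Rmult_0_l, exp_0 in HN; lra.
Qed.

(** For [y > 0] this is the argument of [(u + iy) / (u + 1/2 + iy)], since [x + iy] has argument
    [pi/2 - atan (x/y)]. *)
Definition atan_step (y u : R) : R := atan ((u + 1 / 2) / y) - atan (u / y).

Fixpoint theta_n (y s : R) (n : nat) : R :=
  match n with O => 0 | S m => theta_n y s m + atan_step y (s + INR m) end.

Definition theta (y s : R) : R := real (Lim_seq (theta_n y s)).

Section Theta.
Variables (y : R) (hy : 0 < y).

Lemma div_lt_compat (a b : R) : a < b -> a / y < b / y.
Proof. intros H; apply Rmult_lt_compat_r; auto; now apply Rinv_0_lt_compat. Qed.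

Lemma atan_step_pos (u : R) : 0 < atan_step y u.
Proof.
assert (H : atan (u / y) < atan ((u + 1 / 2) / y)); [ | unfold atan_step; lra].
apply atan_increasing, div_lt_compat; lra.
Qed.

Lemma is_derive_atan_step (u : R) :
  is_derive (atan_step y) u (y / (y * y + (u + 1 / 2) * (u + 1 / 2)) - y / (y * y + u * u)).
Proof.
unfold atan_step; auto_derive; auto.
assert (0 <= (u + 1 / 2) * (u + 1 / 2)) by apply Rle_0_sqr.
assert (0 <= u * u) by apply Rle_0_sqr.
assert (0 < y * y) by nra.
field; repeat split; nra.
Qed.

(** The derivative is negative exactly when [(u + 1/2)^2 > u^2], that is, when [u > -1/4]. *)
Lemma atan_step_decr (u v : R) : - (1 / 4) <= u -> u < v -> atan_step y v < atan_step y u.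
Proof.
intros Hu Huv.
set (df := fun u => y / (y * y + (u + 1 / 2) * (u + 1 / 2)) - y / (y * y + u * u)).
assert (Hd : forall t, - (1 / 4) < t -> df t < 0).
{ intros t Ht; unfold df.
  assert (0 <= t * t) by apply Rle_0_sqr.
  assert (0 < y * y) by nra.
  assert (y / (y * y + (t + 1 / 2) * (t + 1 / 2)) < y / (y * y + t * t)); [ | lra].
  apply Rmult_lt_compat_l; auto; apply Rinv_lt_contravar; [ | nra].
  apply Rmult_lt_0_compat; nra. }
destruct (MVT_cor2 (atan_step y) df u v Huv) as [c [Hc1 Hc2]].
- intros c Hc; apply is_derive_Reals, is_derive_atan_step.
- pose proof (Hd c ltac:(lra)); nra.
Qed.

(** The half-unit steps starting at [s + j] and at [s + 1/2 + j] interlace and tile [[s, s + n]], so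
    the sum telescopes. *)
Lemma theta_n_shift (s : R) (n : nat) :
  theta_n y s n + theta_n y (s + 1 / 2) n = atan ((s + INR n) / y) - atan (s / y).
Proof.
induction n as [ | n IH].
- simpl; rewrite (Rplus_0_r s); ring.
- simpl theta_n; rewrite S_INR; unfold atan_step.
  replace (s + 1 / 2 + INR n + 1 / 2) with (s + (INR n + 1)) by field.
  replace (s + 1 / 2 + INR n) with (s + INR n + 1 / 2) by field.
  lra.
Qed.

Lemma theta_n_nonneg (s : R) (n : nat) : 0 <= theta_n y s n.
Proof. induction n as [ | n IH]; simpl; [lra | pose proof (atan_step_pos (s + INR n)); lra]. Qed.

Lemma theta_n_bound (s : R) (n : nat) : theta_n y s n <= PI / 2 - atan (s / y).
Proof.
pose proof (theta_n_shift s n); pose proof (theta_n_nonneg (s + 1 / 2) n).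
pose proof (atan_bound ((s + INR n) / y)); lra.
Qed.

Lemma is_lim_theta (s : R) : is_lim_seq (theta_n y s) (theta y s).
Proof.
unfold theta; apply Lim_seq_correct'.
apply ex_finite_lim_seq_incr with (PI / 2 - atan (s / y)).
- intros n; simpl; pose proof (atan_step_pos (s + INR n)); lra.
- apply theta_n_bound.
Qed.

Lemma is_lim_seq_atan_shift (s : R) : is_lim_seq (fun n => atan ((s + INR n) / y)) (PI / 2).
Proof.
apply is_lim_seq_spec; intros eps.
pose proof PI_RGT_0.
set (e := Rmin eps (PI / 2)).
assert (He : 0 < e) by (apply Rmin_glb_lt; [apply eps | lra]).
assert (He1 : e <= eps) by apply Rmin_l.
assert (He2 : e <= PI / 2) by apply Rmin_r.
destruct (INR_unbounded (y * tan (PI / 2 - e / 2) - s)) as [N HN].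
exists N; intros n Hn; apply le_INR in Hn.
assert (Hlt : tan (PI / 2 - e / 2) < (s + INR n) / y).
{ apply (Rmult_lt_reg_r y); auto.
  replace ((s + INR n) / y * y) with (s + INR n) by (field; lra); lra. }
apply atan_increasing in Hlt; rewrite atan_tan in Hlt by lra.
pose proof (atan_bound ((s + INR n) / y)).
apply Rabs_def1; lra.
Qed.

Lemma theta_shift (s : R) : theta y s + theta y (s + 1 / 2) = PI / 2 - atan (s / y).
Proof.
assert (H1 : is_lim_seq (fun n => theta_n y s n + theta_n y (s + 1 / 2) n) (theta y s + theta y (s + 1 / 2)))
  by (apply is_lim_seq_plus'; apply is_lim_theta).
assert (H2 : is_lim_seq (fun n => theta_n y s n + theta_n y (s + 1 / 2) n) (PI / 2 - atan (s / y))).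
{ eapply is_lim_seq_ext; [ intros n; symmetry; apply theta_n_shift | ].
  apply is_lim_seq_minus'; [apply is_lim_seq_atan_shift | apply is_lim_seq_const]. }
apply is_lim_seq_unique in H1; apply is_lim_seq_unique in H2.
rewrite H1 in H2; now injection H2.
Qed.

Lemma theta_pos (s : R) : 0 < theta y s.
Proof.
apply Rlt_le_trans with (atan_step y s); [apply atan_step_pos | ].
apply (is_lim_seq_le (fun _ => atan_step y s) (fun n => theta_n y s (S n)) (atan_step y s) (theta y s)).
- intros n; induction n as [ | n IH].
  + simpl; rewrite Rplus_0_r; lra.
  + change (theta_n y s (S (S n))) with (theta_n y s (S n) + atan_step y (s + INR (S n))).
    pose proof (atan_step_pos (s + INR (S n))); lra.
- apply is_lim_seq_const.
- apply (is_lim_seq_incr_1 (theta_n y s)), is_lim_theta.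
Qed.

Lemma theta_lt_PI (s : R) : theta y s < PI.
Proof.
pose proof (theta_shift s); pose proof (theta_pos (s + 1 / 2)); pose proof (atan_bound (s / y)); lra.
Qed.

(** All terms of the series decrease, so the difference is at least that of the first terms; this
    fixed gap keeps the inequality strict in the limit. *)
Lemma theta_decr (s s' : R) : - (1 / 4) <= s -> s < s' -> theta y s' < theta y s.
Proof.
intros Hs Hss.
assert (H : atan_step y s - atan_step y s' <= theta y s - theta y s').
{ apply (is_lim_seq_le (fun _ => atan_step y s - atan_step y s')
    (fun n => theta_n y s (S n) - theta_n y s' (S n)) (atan_step y s - atan_step y s') (theta y s - theta y s')).
  - intros n; induction n as [ | n IH].
    + simpl; rewrite !Rplus_0_r; lra.
    + change (theta_n y s (S (S n))) with (theta_n y s (S n) + atan_step y (s + INR (S n))).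
      change (theta_n y s' (S (S n))) with (theta_n y s' (S n) + atan_step y (s' + INR (S n))).
      pose proof (pos_INR (S n)).
      pose proof (atan_step_decr (s + INR (S n)) (s' + INR (S n)) ltac:(lra) ltac:(lra)); lra.
  - apply is_lim_seq_const.
  - apply is_lim_seq_minus'; apply (is_lim_seq_incr_1 (theta_n y _)), is_lim_theta. }
pose proof (atan_step_decr s s' Hs Hss); lra.
Qed.

Lemma atan_Lipschitz (u v : R) : u <= v -> atan v - atan u <= v - u.
Proof.
intros [Huv | ->]; [ | lra].
destruct (MVT_cor2 atan (fun t => / (1 + t²)) u v Huv) as [c [Hc _]].
- intros c _; apply is_derive_Reals, is_derive_atan.
- rewrite Hc; assert (/ (1 + c²) <= / 1); [ | rewrite Rinv_1 in *; nra].
  apply Rinv_le_contravar; [lra | pose proof (Rle_0_sqr c); lra].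
Qed.

(* Both summands of [theta_shift] decrease, so each varies less than their sum. *)
Lemma theta_Lipschitz (s s' : R) : - (1 / 4) <= s -> s <= s' ->
  0 <= theta y s - theta y s' <= (s' - s) / y.
Proof.
intros Hs [Hss | <-]; [ | split; [lra | unfold Rdiv; lra]].
pose proof (theta_decr s s' Hs Hss).
pose proof (theta_decr (s + 1 / 2) (s' + 1 / 2) ltac:(lra) ltac:(lra)).
pose proof (theta_shift s); pose proof (theta_shift s').
pose proof (div_lt_compat s s' Hss).
pose proof (atan_Lipschitz (s / y) (s' / y) ltac:(lra)).
replace ((s' - s) / y) with (s' / y - s / y) by (field; lra); lra.
Qed.

(** The values at -1/4 and 1/4 add up to [pi/2 + atan (1/(4y))], more than [pi/2], and the first is
    the larger. *)
Lemma theta_left_gt : PI / 4 < theta y (- (1 / 4)).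
Proof.
pose proof (theta_shift (- (1 / 4))) as H.
pose proof (theta_decr (- (1 / 4)) (- (1 / 4) + 1 / 2) ltac:(lra) ltac:(lra)).
assert (atan (- (1 / 4) / y) < atan 0).
{ apply atan_increasing; replace 0 with (0 / y) by (field; lra); apply div_lt_compat; lra. }
rewrite atan_0 in *; lra.
Qed.

Lemma theta_attains (c : R) :
  theta y (1 / 4) < c < theta y (- (1 / 4)) -> exists s, - (1 / 4) < s < 1 / 4 /\ theta y s = c.
Proof.
intros Hc.
(* [IVT] asks for continuity on the whole line, but the Lipschitz bound holds only from -1/4 on;
   hence [theta] is composed with the projection onto [[-1/4, 1/4]]. *)
set (k := fun s => Rmax (- (1 / 4)) (Rmin s (1 / 4))).
assert (Hk0 : forall s, - (1 / 4) <= k s) by (intros; apply Rmax_l).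
assert (Hk : forall s t, s <= t -> k s <= k t <= k s + (t - s)).
{ intros s t H; unfold k, Rmax, Rmin; repeat destruct (Rle_dec _ _); lra. }
set (f := fun s => c - theta y (k s)).
assert (Hf : continuity f).
{ intros s eps He.
  exists (eps * y); split; [apply Rmult_lt_0_compat; auto | ].
  intros t [_ Ht]; revert Ht; simpl; unfold R_dist, f; intros Ht.
  replace (c - theta y (k t) - (c - theta y (k s))) with (theta y (k s) - theta y (k t)) by ring.
  apply Rabs_def2 in Ht.
  assert (Hd : forall a b, a <= b -> b - a < eps * y -> 0 <= theta y (k a) - theta y (k b) < eps).
  { intros a b Hab Hlt; pose proof (Hk a b Hab).
    pose proof (theta_Lipschitz (k a) (k b) (Hk0 a) ltac:(lra)) as [H1 H2].
    split; auto; eapply Rle_lt_trans; [ exact H2 | ].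
    apply (Rmult_lt_reg_r y); auto.
    replace ((k b - k a) / y * y) with (k b - k a) by (field; lra); lra. }
  apply Rabs_def1; destruct (Rle_lt_dec s t).
  - pose proof (Hd s t ltac:(lra) ltac:(lra)); lra.
  - pose proof (Hd t s ltac:(lra) ltac:(lra)); lra.
  - pose proof (Hd s t ltac:(lra) ltac:(lra)); lra.
  - pose proof (Hd t s ltac:(lra) ltac:(lra)); lra. }
assert (Ek : forall s, - (1 / 4) <= s <= 1 / 4 -> k s = s).
{ intros s H; unfold k, Rmax, Rmin; repeat destruct (Rle_dec _ _); lra. }
destruct (IVT f (- (1 / 4)) (1 / 4) Hf) as [s [Hs1 Hs2]]; try lra;
  try (unfold f; rewrite Ek by lra; lra).
unfold f in Hs2; rewrite Ek in Hs2 by lra.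
assert (Hs3 : theta y s = c) by lra.
exists s; split; auto.
destruct Hs1 as [[H1 | <-] [H2 | ->]]; lra.
Qed.

Lemma polar_upper (x : R) :
  exists rho, 0 < rho /\ ((x, y) : C) = (RtoC rho * cis (PI / 2 - atan (x / y)))%C.
Proof.
exists (y * sqrt (1 + (x / y)²)).
assert (H : 0 < sqrt (1 + (x / y)²)) by (apply sqrt_lt_R0; pose proof (Rle_0_sqr (x / y)); lra).
split; [now apply Rmult_lt_0_compat | ].
unfold cis, cexp, Re, Im; simpl.
rewrite exp_0, cos_shift, sin_shift, sin_atan, cos_atan.
apply injective_projections; simpl; field; split; lra.
Qed.

(** This is [Gamma(s+1/2+iy) / Gamma(s+iy)] with the denominator shifted once, so that both factors
    are Euler integrals even for negative [s > -1/2]. *)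
Definition Gamma_quot (s : R) : C := ((s, y) * Gamma_int ((s + 1 / 2)%R, y) / Gamma_int ((s + 1)%R, y))%C.

Lemma upper_neq_0 (x : R) : ((x, y) : C) <> 0%C.
Proof. intros E; injection E; lra. Qed.

Lemma Gamma_quot_step (s : R) : - (1 / 2) < s -> Gamma_quot s = ((s, y) / ((s + 1 / 2)%R, y) * Gamma_quot (s + 1))%C.
Proof.
intros Hs; unfold Gamma_quot.
replace (s + 1 + 1 / 2, y) with (((s + 1 / 2)%R, y) + 1)%C by (apply injective_projections; simpl; field).
replace (s + 1 + 1, y) with (((s + 1)%R, y) + 1)%C by (apply injective_projections; simpl; field).
rewrite !Gamma_int_S by (simpl; lra).
field; repeat split; try apply upper_neq_0; apply Gamma_int_neq_0; simpl; lra.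
Qed.

(** Each use of the functional equation contributes a positive factor, absorbed in [rho], and the
    angle [atan_step]. *)
Lemma Gamma_quot_iter (s : R) (n : nat) : - (1 / 2) < s ->
  exists rho, 0 < rho /\ Gamma_quot s = (RtoC rho * cis (theta_n y s n) * Gamma_quot (s + INR n))%C.
Proof.
intros Hs; induction n as [ | n [rho [Hr IH]]].
- exists 1; split; [lra | ].
  simpl; rewrite cis_0, Rplus_0_r; ring.
- pose proof (pos_INR n) as Hn.
  rewrite (Gamma_quot_step (s + INR n)) in IH by lra.
  destruct (polar_upper (s + INR n)) as [r1 [Hr1 E1]].
  destruct (polar_upper (s + INR n + 1 / 2)) as [r2 [Hr2 E2]].
  exists (rho * r1 / r2); split.
  { apply Rdiv_lt_0_compat; auto; now apply Rmult_lt_0_compat. }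
  rewrite IH, E1, E2, S_INR.
  replace (s + INR n + 1) with (s + (INR n + 1)) by ring.
  set (a1 := atan ((s + INR n) / y)); set (a2 := atan ((s + INR n + 1 / 2) / y)).
  assert (E : cis (theta_n y s (S n)) =
    (cis (theta_n y s n) * cis (PI / 2 - a1) / cis (PI / 2 - a2))%C).
  { replace (theta_n y s (S n)) with (theta_n y s n + (PI / 2 - a1) + - (PI / 2 - a2))
      by (simpl; unfold atan_step; fold a1 a2; ring).
    now rewrite !cis_plus, cis_opp. }
  rewrite E; unfold Rdiv; rewrite !RtoC_mult, RtoC_inv by lra.
  field; split; [ apply cis_neq_0 | intros E0; apply RtoC_inj in E0; lra].
Qed.

(** The common phase [u], later [n^{iy}], cancels in the quotient. The condition [eta <= 1/2] gives
    [|g2| >= r2/2], which turns the numerator bound [2 eta r1 r2] into the constant 4. *)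
Lemma near_pos_ratio (r1 r2 eta : R) (u g1 g2 : C) :
  0 < r1 -> 0 < r2 -> 0 < eta <= 1 / 2 -> Cmod u = 1 ->
  Cmod (g1 - u * RtoC r1) <= eta * r1 -> Cmod (g2 - u * RtoC r2) <= eta * r2 ->
  Cmod (g1 / g2 - RtoC (r1 / r2)) <= 4 * eta * (r1 / r2).
Proof.
intros H1 H2 He Hu Hg1 Hg2.
assert (Hm : r2 / 2 <= Cmod g2).
{ assert (Ht : Cmod (u * RtoC r2) <= Cmod g2 + Cmod (- (g2 - u * RtoC r2))).
  { eapply Rle_trans; [ | apply Cmod_triangle]; right; f_equal; ring. }
  rewrite Cmod_opp, Cmod_mult, Hu, Cmod_R, Rabs_pos_eq in Ht by lra; nra. }
assert (Hg : g2 <> 0%C) by (apply Cmod_gt_0; lra).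
assert (Hr2 : RtoC r2 <> 0%C) by (intros E; apply RtoC_inj in E; lra).
replace (g1 / g2 - RtoC (r1 / r2))%C with
  (((g1 - u * RtoC r1) * RtoC r2 - (g2 - u * RtoC r2) * RtoC r1) / (g2 * RtoC r2))%C.
2:{ unfold Rdiv; rewrite RtoC_mult, RtoC_inv by lra; field; auto. }
rewrite Cmod_div by (apply Cmult_neq_0; auto).
rewrite Cmod_mult, (Cmod_R r2), (Rabs_pos_eq r2) by lra.
assert (Hn : Cmod ((g1 - u * RtoC r1) * RtoC r2 - (g2 - u * RtoC r2) * RtoC r1) <= 2 * eta * r1 * r2).
{ unfold Cminus at 1; eapply Rle_trans; [ apply Cmod_triangle | ].
  rewrite Cmod_opp, !Cmod_mult, !Cmod_R, !Rabs_pos_eq by lra; nra. }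
apply (Rmult_le_reg_r (Cmod g2 * r2)); [ apply Rmult_lt_0_compat; lra | ].
replace (_ / (Cmod g2 * r2) * (Cmod g2 * r2)) with
  (Cmod ((g1 - u * RtoC r1) * RtoC r2 - (g2 - u * RtoC r2) * RtoC r1)) by (field; split; lra).
eapply Rle_trans; [ exact Hn | ].
replace (4 * eta * (r1 / r2) * (Cmod g2 * r2)) with (4 * eta * r1 * Cmod g2) by (field; lra).
assert (0 < eta * r1) by nra. nra.
Qed.

Lemma Gamma_quot_near_pos (s eta : R) : - (1 / 2) < s -> 0 < eta <= 1 / 2 ->
  exists N : nat, forall n, (N <= n)%nat ->
  exists p, 0 < p /\ Cmod (Gamma_quot (s + INR n) - RtoC p) <= 4 * eta * p.
Proof.
intros Hs He.
destruct (Gamma_int_asymp (s + 5 / 2) y eta) as [N1 H1]; try lra.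
destruct (Gamma_int_asymp (s + 2) y eta) as [N2 H2]; try lra.
(* Three units are set aside: one makes the base [INR (S n)] positive, two raise the shifts to
   [s + 2] and [s + 5/2], above the value 1 that [Gamma_int_asymp] requires. *)
exists (S (S (S (N1 + N2)))); intros n Hn.
destruct n as [ | [ | [ | n]]]; try lia.
specialize (H1 n ltac:(lia)); specialize (H2 n ltac:(lia)).
pose proof (pos_INR (S n)) as Hn0.
set (r1 := rGamma (INR (S n) + (s + 5 / 2))) in *; set (r2 := rGamma (INR (S n) + (s + 2))) in *.
assert (Hr1 : 0 < r1) by (apply rGamma_pos; lra).
assert (Hr2 : 0 < r2) by (apply rGamma_pos; lra).
exists (r1 / r2); split; [now apply Rdiv_lt_0_compat | ].
replace (Gamma_quot (s + INR (S (S (S n))))) with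
  (Gamma_int ((INR (S n) + (s + 5 / 2))%R, y) / Gamma_int ((INR (S n) + (s + 2))%R, y))%C.
- apply (near_pos_ratio r1 r2 eta (cpowR (INR (S n)) (0, y))); auto.
  rewrite Cmod_cpowR; unfold Re, Rpower; simpl fst; rewrite Rmult_0_l; apply exp_0.
- unfold Gamma_quot; rewrite (S_INR (S (S n))), (S_INR (S n)).
  clear - Hs hy Hn0; set (k := INR (S n)) in *; clearbody k.
  replace (s + (k + 1 + 1)) with (k + (s + 2)) by ring.
  replace (k + (s + 2) + 1 / 2) with (k + (s + 5 / 2)) by field.
  replace (k + (s + 2) + 1, y) with (((k + (s + 2))%R, y) + 1)%C
    by (apply injective_projections; simpl; ring).
  rewrite (Gamma_int_S (k + (s + 2), y)) by (unfold Re; simpl fst; lra).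
  field; split; [ apply Gamma_int_neq_0; unfold Re; simpl fst; lra | apply upper_neq_0].
Qed.

Lemma Gamma_quot_neq_0 (s : R) : - (1 / 2) < s -> Gamma_quot s <> 0%C.
Proof.
intros Hs; unfold Gamma_quot, Cdiv; apply Cmult_neq_0; [apply Cmult_neq_0 | ].
- apply upper_neq_0.
- apply Gamma_int_neq_0; simpl; lra.
- apply Cinv_neq_0, Gamma_int_neq_0; simpl; lra.
Qed.

(** [X t] and [Y t] are the real and imaginary parts of the fixed number [Gamma_quot s] rotated by
    [-t]. At [t = theta_n y s n] the rotated number is a positive multiple of [Gamma_quot (s + n)],
    hence nearly on the positive axis. Only the angle passes to the limit; the accumulated moduli
    [rho] need not converge. *)
Lemma Gamma_quot_polar (s : R) : - (1 / 2) < s ->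
  exists rho, 0 < rho /\ Gamma_quot s = (RtoC rho * cis (theta y s))%C.
Proof.
intros Hs.
set (a := Re (Gamma_quot s)); set (b := Im (Gamma_quot s)).
set (X := fun t => a * cos t + b * sin t); set (Y := fun t => b * cos t - a * sin t).
assert (HX : is_lim_seq (fun n => X (theta_n y s n)) (X (theta y s))).
{ apply is_lim_seq_continuous; [ | apply is_lim_theta].
  unfold X; reg. }
assert (HY : is_lim_seq (fun n => Y (theta_n y s n)) (Y (theta y s))).
{ apply is_lim_seq_continuous; [ | apply is_lim_theta].
  unfold Y; reg. }
assert (Hn : forall eta, 0 < eta <= 1 / 8 -> exists N : nat, forall n, (N <= n)%nat ->
   0 <= X (theta_n y s n) /\ Rabs (Y (theta_n y s n)) <= 8 * eta * X (theta_n y s n)).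
{ intros eta He; destruct (Gamma_quot_near_pos s eta Hs ltac:(lra)) as [N HN]; exists N; intros n Hn.
  destruct (HN n Hn) as [p [Hp Hd]].
  destruct (Gamma_quot_iter s n Hs) as [rho [Hr E]].
  set (w := Gamma_quot (s + INR n)) in *; set (t := theta_n y s n) in *.
  assert (E1 : X t = rho * Re w /\ Y t = rho * Im w).
  { unfold X, Y, a, b; rewrite E; unfold cis, cexp, Re, Im; simpl; rewrite exp_0.
    pose proof (sin2_cos2 t) as Ht; unfold Rsqr in Ht.
    assert (E2 : cos t * cos t = 1 - sin t * sin t) by lra.
    split; ring_simplify; simpl; rewrite ?Rmult_1_r, ?E2; ring. }
  destruct E1 as [-> ->].
  assert (H1 : Rabs (Re w - p) <= 4 * eta * p).
  { eapply Rle_trans; [ | exact Hd]; apply (re_le_Cmod (w - RtoC p)). }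
  assert (H2 : Rabs (Im w) <= 4 * eta * p).
  { eapply Rle_trans; [ | exact Hd].
    eapply Rle_trans; [ | apply Rmax_Cmod]; eapply Rle_trans; [ | apply Rmax_r].
    simpl; unfold Im; rewrite Ropp_0, Rplus_0_r; lra. }
  apply Rabs_le_between in H1.
  assert (H3 : p / 2 <= Re w) by nra.
  split; [ nra | ].
  rewrite Rabs_mult, (Rabs_pos_eq rho) by lra.
  assert (Rabs (Im w) <= 8 * eta * Re w) by nra. nra. }
assert (HX0 : 0 <= X (theta y s)).
{ destruct (Hn (1 / 8) ltac:(lra)) as [N HN].
  apply (is_lim_seq_le_loc (fun _ => 0) (fun n => X (theta_n y s n)) 0 (X (theta y s))); auto.
  - exists N; intros n H; apply HN; auto.
  - apply is_lim_seq_const. }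
assert (HY0 : Y (theta y s) = 0).
{ assert (Ha : forall eta, 0 < eta <= 1 / 8 -> Rabs (Y (theta y s)) <= 8 * eta * X (theta y s)).
  { intros eta He; destruct (Hn eta He) as [N HN].
    apply (is_lim_seq_le_loc (fun n => Rabs (Y (theta_n y s n))) (fun n => 8 * eta * X (theta_n y s n))
      (Rabs (Y (theta y s))) (8 * eta * X (theta y s))).
    - exists N; intros n H; apply HN; auto.
    - apply (is_lim_seq_abs _ (Y (theta y s))); auto.
    - apply (is_lim_seq_scal_l _ (8 * eta) (X (theta y s))); auto. }
  destruct (Req_dec (Y (theta y s)) 0) as [ | Hne]; auto; exfalso.
  apply Rabs_pos_lt in Hne; set (q := Rabs (Y (theta y s))) in *.
  set (x := X (theta y s)) in *.
  pose proof (Ha (1 / 8) ltac:(lra)) as H8.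
  assert (Hx : 0 < x) by lra.
  (* With this [eta] the bound reads [q <= q/2]. *)
  assert (He : 0 < q / (16 * x)) by (apply Rdiv_lt_0_compat; lra).
  assert (He' : q / (16 * x) <= 1 / 8).
  { apply (Rmult_le_reg_r (16 * x)); [lra | ].
    replace (q / (16 * x) * (16 * x)) with q by (field; lra); lra. }
  pose proof (Ha _ (conj He He')) as H.
  replace (8 * (q / (16 * x)) * x) with (q / 2) in H by (field; lra); lra. }
assert (E : Gamma_quot s = (RtoC (X (theta y s)) * cis (theta y s))%C).
{ assert (Ef : Gamma_quot s = (a, b)) by apply surjective_pairing.
  rewrite Ef; unfold cis, cexp, Re, Im; simpl; rewrite exp_0.
  pose proof (sin2_cos2 (theta y s)) as Ht; unfold Rsqr in Ht; unfold X, Y in *.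
  set (ct := cos (theta y s)) in *; set (st := sin (theta y s)) in *.
  apply injective_projections; simpl.
  - replace a with (a * (st * st + ct * ct)) at 1 by (rewrite Ht; ring).
    transitivity ((a * ct + b * st) * ct - st * (b * ct - a * st)); [ring | rewrite HY0; ring].
  - replace b with (b * (st * st + ct * ct)) at 1 by (rewrite Ht; ring).
    transitivity ((a * ct + b * st) * st + ct * (b * ct - a * st)); [ring | rewrite HY0; ring]. }
exists (X (theta y s)); split; auto.
destruct HX0 as [ | HX0]; auto; exfalso.
apply (Gamma_quot_neq_0 s Hs); rewrite E, <- HX0; ring.
Qed.

End Theta.

(** * Weber's integral *)

Definition weber_integrand (a z : C) (t : R) : C :=
  (cexp (- z * RtoC t) * RtoC (exp (- t ^ 2 / 2)) * cpowR t (a - 1))%C.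

Definition weber_int (a z : C) : C := CInt0inf (weber_integrand a z).

Lemma Re_le_Cmod (z : C) : Re z <= Cmod z.
Proof. eapply Rle_trans; [apply Rle_abs | apply re_le_Cmod]. Qed.

Lemma is_derive_weber_kernel (z b : C) (t : R) : 0 < t ->
  @is_derive R_AbsRing CN (fun t => cexp (- z * RtoC t) * RtoC (exp (- t ^ 2 / 2)) * cpowR t b)%C t
    ((- z - RtoC t + b * RtoC (/ t)) * (cexp (- z * RtoC t) * RtoC (exp (- t ^ 2 / 2)) * cpowR t b))%C.
Proof.
intros Ht; eapply is_derive_C_eq.
- apply (is_derive_C_mult (fun t => cexp (- z * RtoC t) * RtoC (exp (- t ^ 2 / 2)))%C (fun t => cpowR t b)).
  + apply (is_derive_C_mult (fun t => cexp (- z * RtoC t)) (fun t => RtoC (exp (- t ^ 2 / 2)))).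
    * apply (is_derive_cexp (fun t => - z * RtoC t)%C), is_derive_C_scal.
      apply (is_derive_RtoC (fun t => t)), is_derive_id.
    * apply (is_derive_RtoC (fun t => exp (- t ^ 2 / 2)) t (- t * exp (- t ^ 2 / 2))).
      apply (is_derive_exp_comp (fun t => - t ^ 2 / 2)); auto_derive; auto; field.
  + now apply is_derive_cpowR.
- rewrite RtoC_mult, RtoC_opp; change (@one R_AbsRing) with 1; ring.
Qed.

Lemma continuous_weber_integrand (a z : C) (t : R) : 0 < t -> @continuous R_UniformSpace CN (weber_integrand a z) t.
Proof.
intros Ht; eapply is_derive_C_continuous; unfold weber_integrand; now apply (is_derive_weber_kernel z (a - 1)).
Qed.

(** Completing the square. The Gaussian absorbs the growth of [e^{-zt}] and still leaves an
    [e^{-t}], so [gamma_dom] is a majorant for every [z]. *)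
Lemma weber_weight_bound (M t : R) : exp (M * t) * exp (- t ^ 2 / 2) <= exp ((M + 1) ^ 2 / 2) * exp (- t).
Proof.
rewrite <- !exp_plus; apply exp_le_compat.
assert (0 <= (t - (M + 1)) ^ 2) by apply pow2_ge_0. nra.
Qed.

Lemma Cmod_weber_integrand_le (a z : C) (t : R) : 0 < t ->
  Cmod (weber_integrand a z t) <= exp ((Cmod z + 1) ^ 2 / 2) * gamma_dom (Re a) t.
Proof.
intros Ht; unfold weber_integrand, gamma_dom.
rewrite !Cmod_mult, Cmod_cexp, Cmod_R, Rabs_pos_eq, Cmod_cpowR by (left; apply exp_pos).
replace (Re (a - 1)) with (Re a - 1) by reflexivity.
replace (Re (- z * RtoC t)) with (Re (- z) * t) by (unfold Re; simpl; ring).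
assert (Hp : 0 < Rpower t (Re a - 1)) by apply exp_pos.
assert (He : exp (Re (- z) * t) <= exp (Cmod z * t)).
{ apply exp_le_compat, Rmult_le_compat_r; [lra | ].
  rewrite <- Cmod_opp; apply Re_le_Cmod. }
pose proof (weber_weight_bound (Cmod z) t).
pose proof (exp_pos (- t ^ 2 / 2)).
replace (_ * (Rpower _ _ * _)) with (exp ((Cmod z + 1) ^ 2 / 2) * exp (- t) * Rpower t (Re a - 1)) by ring.
apply Rmult_le_compat_r; nra.
Qed.

Lemma is_CInt_weber_int (a z : C) : 0 < Re a -> is_CInt (weber_integrand a z) (weber_int a z).
Proof.
intros Ha; apply (is_CInt_correct _ (Re a) (exp ((Cmod z + 1) ^ 2 / 2))); auto.
- intros; now apply continuous_weber_integrand.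
- intros; now apply Cmod_weber_integrand_le.
Qed.

Lemma weber_integrand_S (a z : C) (t : R) : 0 < t -> weber_integrand (a + 1) z t = (RtoC t * weber_integrand a z t)%C.
Proof.
intros Ht; unfold weber_integrand.
replace (a + 1 - 1)%C with (a - 1 + 1)%C by ring; rewrite cpowR_plus, cpowR_1 by auto; ring.
Qed.

Lemma RtoC_neq_0 (x : R) : x <> 0 -> RtoC x <> 0%C.
Proof. intros H E; apply RtoC_inj in E; auto. Qed.

(** The integral of the derivative of [e^{-zt - t^2/2} t^a] vanishes; this is the three-term
    recurrence of the parabolic cylinder functions at the level of integrals. *)
Lemma weber_int_rec (a z : C) : 0 < Re a -> weber_int (a + 2) z = (a * weber_int a z - z * weber_int (a + 1) z)%C.
Proof.
intros Ha.
set (f := fun t => (a * weber_integrand a z t + (- z * weber_integrand (a + 1) z t + - (1) * weber_integrand (a + 2) z t))%C).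
assert (H1 : is_CInt f (a * weber_int a z + (- z * weber_int (a + 1) z + - (1) * weber_int (a + 2) z))%C).
{ apply is_CInt_plus; [ | apply is_CInt_plus]; apply is_CInt_scal, is_CInt_weber_int; unfold Re in *; simpl; lra. }
assert (H0 : is_CInt f (RtoC 0)).
{ apply (is_CInt_derive_0 (weber_integrand (a + 1) z) _ (Re a) (exp ((Cmod z + 1) ^ 2 / 2))); auto.
  - intros t Ht; eapply is_derive_C_eq.
    + unfold weber_integrand; now apply (is_derive_weber_kernel z (a + 1 - 1)).
    + fold (weber_integrand (a + 1) z t); unfold f.
      replace (a + 2)%C with (a + 1 + 1)%C by ring.
      rewrite !(weber_integrand_S _ z t) by auto.
      rewrite RtoC_inv by lra; field; apply RtoC_neq_0; lra.
  - intros t Ht; apply (continuous_C_plus (fun t => a * weber_integrand a z t)%C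
      (fun t => - z * weber_integrand (a + 1) z t + - (1) * weber_integrand (a + 2) z t)%C);
    [ | apply (continuous_C_plus (fun t => - z * weber_integrand (a + 1) z t)%C (fun t => - (1) * weber_integrand (a + 2) z t)%C)];
    eapply is_derive_C_continuous; apply is_derive_C_scal; unfold weber_integrand; now apply is_derive_weber_kernel.
  - intros t Ht; now apply (Cmod_weber_integrand_le (a + 1)). }
pose proof (is_CInt_unique _ _ H1) as E; rewrite (is_CInt_unique _ _ H0) in E.
replace (weber_int (a + 2) z) with (a * weber_int a z - z * weber_int (a + 1) z -
  (a * weber_int a z + (- z * weber_int (a + 1) z + - (1) * weber_int (a + 2) z)))%C by ring.
rewrite <- E; ring.
Qed.

Lemma Cmod_mean_value (F f : R -> C) (M : R) :
  (forall t, 0 <= t <= 1 -> @is_derive R_AbsRing CN F t (f t)) ->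
  (forall t, 0 <= t <= 1 -> @continuous R_UniformSpace CN f t) ->
  (forall t, 0 <= t <= 1 -> Cmod (f t) <= M) ->
  Cmod (F 1 - F 0) <= M.
Proof.
intros HF Hf HM; rewrite <- norm_Cmod.
apply (@norm_RInt_le CN f (fun _ => M) 0 1); try lra.
- intros t Ht; rewrite norm_Cmod; auto.
- apply (@is_RInt_derive CV F f); intros t; rewrite Rmin_left, Rmax_right by lra; auto.
- pose proof (@is_RInt_const R_NormedModule 0 1 M) as H.
  refine (eq_ind ((1 - 0) * M) (fun l => is_RInt (fun _ : R => M) 0 1 l) H M _); ring.
Qed.

Lemma is_derive_cexp_line (v : C) (t : R) :
  @is_derive R_AbsRing CN (fun t => cexp (v * RtoC t)) t (v * cexp (v * RtoC t))%C.
Proof.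
eapply is_derive_C_eq.
- apply (is_derive_cexp (fun t => v * RtoC t)%C), is_derive_C_scal.
  apply (is_derive_RtoC (fun t => t)), is_derive_id.
- change (@one R_AbsRing) with 1; ring.
Qed.

Lemma Cmod_cexp_line_le (v : C) (t : R) : 0 <= t <= 1 -> Cmod (cexp (v * RtoC t)) <= exp (Cmod v).
Proof.
intros Ht; rewrite Cmod_cexp; apply exp_le_compat.
eapply Rle_trans; [ apply Re_le_Cmod | ].
rewrite Cmod_mult, Cmod_R, Rabs_pos_eq by lra; pose proof (Cmod_ge_0 v); nra.
Qed.

Lemma Cmod_cexp_minus_1 (v : C) : Cmod (cexp v - 1) <= Cmod v * exp (Cmod v).
Proof.
replace (cexp v - 1)%C with (cexp (v * RtoC 1) - cexp (v * RtoC 0))%C.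
2:{ rewrite Cmult_1_r, Cmult_0_r, cexp_0; reflexivity. }
apply (Cmod_mean_value (fun t => cexp (v * RtoC t)) (fun t => v * cexp (v * RtoC t))%C).
- intros; apply is_derive_cexp_line.
- intros; eapply is_derive_C_continuous; apply is_derive_C_scal, is_derive_cexp_line.
- intros; rewrite Cmod_mult; apply Rmult_le_compat_l; [ apply Cmod_ge_0 | now apply Cmod_cexp_line_le].
Qed.

Lemma Cmod_cexp_minus_2 (v : C) : Cmod (cexp v - 1 - v) <= Cmod v ^ 2 * exp (Cmod v).
Proof.
set (F := fun t : R => (cexp (v * RtoC t) + - v * RtoC t)%C).
set (f := fun t : R => (v * cexp (v * RtoC t) + - v)%C).
assert (HF : forall t, @is_derive R_AbsRing CN F t (f t)).
{ intros t; apply is_derive_C_plus; [apply is_derive_cexp_line | ].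
  eapply is_derive_C_eq.
  - apply is_derive_C_scal, (is_derive_RtoC (fun t => t)), is_derive_id.
  - change (@one R_AbsRing) with 1; ring. }
replace (cexp v - 1 - v)%C with (F 1 - F 0)%C.
2:{ unfold F; rewrite Cmult_1_r, Cmult_0_r, cexp_0; ring. }
apply (Cmod_mean_value F f); auto.
- intros t Ht; eapply is_derive_C_continuous; apply is_derive_C_plus;
  [apply is_derive_C_scal, is_derive_cexp_line | apply is_derive_C_const].
- intros t Ht; unfold f.
  replace (v * cexp (v * RtoC t) + - v)%C with (v * (cexp (v * RtoC t) - 1))%C by ring.
  rewrite Cmod_mult.
  pose proof (Cmod_cexp_minus_1 (v * RtoC t)) as H.
  rewrite Cmod_mult, Cmod_R, Rabs_pos_eq in H by lra.
  pose proof (Cmod_ge_0 v) as Hv.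
  assert (exp (Cmod v * t) <= exp (Cmod v)) by (apply exp_le_compat; nra).
  pose proof (exp_pos (Cmod v * t)); pose proof (exp_pos (Cmod v)).
  assert (Cmod v * t * exp (Cmod v * t) <= Cmod v * exp (Cmod v)).
  { apply Rmult_le_compat; nra. }
  nra.
Qed.

(** A quadratic remainder can be estimated inside an integral, so this criterion replaces a theorem
    on differentiation under the integral sign. *)
Lemma is_derive_quadratic (f : R -> C) (x : R) (l : C) (K : R) : 0 <= K ->
  (forall x', Rabs (x' - x) <= 1 -> Cmod (f x' - f x - RtoC (x' - x) * l) <= K * (x' - x) ^ 2) ->
  @is_derive R_AbsRing CN f x l.
Proof.
intros HK H; split.
- apply (@is_linear_scal_l R_AbsRing CN).
- intros x0 Hx0.
  replace x0 with x by (apply (@is_filter_lim_locally_unique R_AbsRing R_NormedModule); auto).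
  intros eps.
  assert (Hd : 0 < Rmin 1 (eps / (K + 1))).
  { apply Rmin_glb_lt; [lra | apply Rdiv_lt_0_compat; [apply eps | lra]]. }
  exists (mkposreal _ Hd); intros x' Hx'.
  change (Rabs (x' - x) < Rmin 1 (eps / (K + 1))) in Hx'.
  rewrite norm_Cmod, scal_RtoC.
  change (Cmod (f x' - f x - RtoC (x' - x) * l) <= eps * Rabs (x' - x)).
  assert (H1 : Rabs (x' - x) <= 1) by (pose proof (Rmin_l 1 (eps / (K + 1))); lra).
  assert (H2 : Rabs (x' - x) <= eps / (K + 1)) by (pose proof (Rmin_r 1 (eps / (K + 1))); lra).
  eapply Rle_trans; [ apply H; auto | ].
  rewrite <- pow2_abs; simpl; rewrite Rmult_1_r, <- Rmult_assoc.
  apply Rmult_le_compat_r; [apply Rabs_pos | ].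
  apply Rle_trans with (K * (eps / (K + 1))); [now apply Rmult_le_compat_l | ].
  apply Rle_trans with ((K + 1) * (eps / (K + 1))).
  + apply Rmult_le_compat_r; [ | lra].
    apply Rmult_le_pos; [left; apply eps | left; apply Rinv_0_lt_compat; lra].
  + right; field; lra.
Qed.

Lemma is_derive_weber_int (a c : C) (x : R) : 0 < Re a ->
  @is_derive R_AbsRing CN (fun x => weber_int a (c * RtoC x)) x (- c * weber_int (a + 1) (c * RtoC x))%C.
Proof.
intros Ha.
set (m := Cmod c); assert (Hm : 0 <= m) by apply Cmod_ge_0.
(* The summand [m |x|] covers the integrand at [x], the other [m] the factor [e^{|v|}] for
   [|x' - x| <= 1]. The factor [|v|^2] supplies [t^2] and raises the moment to [Re a + 2]. *)
set (M := m * Rabs x + m).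
set (E := exp ((M + 1) ^ 2 / 2)).
assert (HE : 0 < E) by apply exp_pos.
assert (HG : 0 < rGamma (Re a + 2)) by (apply rGamma_pos; lra).
apply (is_derive_quadratic _ _ _ (m ^ 2 * E * rGamma (Re a + 2))).
{ apply Rmult_le_pos; [apply Rmult_le_pos; [apply pow2_ge_0 | ] | ]; lra. }
intros x' Hx'.
set (d := x' - x) in *.
set (f := fun t => (weber_integrand a (c * RtoC x') t + (- (1) * weber_integrand a (c * RtoC x) t + RtoC d * c * weber_integrand (a + 1) (c * RtoC x) t))%C).
assert (Hf : is_CInt f (weber_int a (c * RtoC x') + (- (1) * weber_int a (c * RtoC x) + RtoC d * c * weber_int (a + 1) (c * RtoC x)))%C).
{ apply is_CInt_plus; [ | apply is_CInt_plus; apply is_CInt_scal]; apply is_CInt_weber_int; unfold Re in *; simpl; lra. }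
replace (_ - _ - _)%C with (weber_int a (c * RtoC x') + (- (1) * weber_int a (c * RtoC x) + RtoC d * c * weber_int (a + 1) (c * RtoC x)))%C by ring.
apply (Cmod_CInt_le f (fun t => m ^ 2 * E * d ^ 2 * gamma_dom (Re a + 2) t)); auto.
2:{ replace (m ^ 2 * E * rGamma (Re a + 2) * d ^ 2) with (m ^ 2 * E * d ^ 2 * rGamma (Re a + 2)) by ring.
    apply is_RInt0_scal, is_RInt0_rGamma; lra. }
intros t Ht; unfold f; rewrite weber_integrand_S by auto.
set (v := (- c * RtoC d * RtoC t)%C).
replace (_ + _)%C with ((cexp v - 1 - v) * weber_integrand a (c * RtoC x) t)%C.
2:{ unfold weber_integrand.
    replace (- (c * RtoC x') * RtoC t)%C with (v + - (c * RtoC x) * RtoC t)%C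
      by (unfold v, d; rewrite RtoC_minus; ring).
    rewrite cexp_plus; unfold v; ring. }
rewrite Cmod_mult.
assert (Hv : Cmod v = m * Rabs d * t).
{ unfold v; rewrite !Cmod_mult, Cmod_opp, !Cmod_R, (Rabs_pos_eq t) by lra; reflexivity. }
pose proof (Cmod_cexp_minus_2 v) as H2; rewrite Hv in H2.
pose proof (Rabs_pos d) as Hd0.
assert (Hj : Cmod (weber_integrand a (c * RtoC x) t) <= exp (m * Rabs x * t) * exp (- t ^ 2 / 2) * Rpower t (Re a - 1)).
{ unfold weber_integrand; rewrite !Cmod_mult, Cmod_cexp, Cmod_R, Rabs_pos_eq, Cmod_cpowR by (left; apply exp_pos).
  replace (Re (a - 1)) with (Re a - 1) by reflexivity.
  apply Rmult_le_compat_r; [left; apply exp_pos | ].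
  apply Rmult_le_compat_r; [left; apply exp_pos | ].
  apply exp_le_compat; eapply Rle_trans; [apply Re_le_Cmod | ].
  rewrite !Cmod_mult, Cmod_opp, Cmod_mult, !Cmod_R, (Rabs_pos_eq t) by lra; apply Rle_refl. }
assert (Hev : exp (m * Rabs d * t) <= exp (m * t)).
{ apply exp_le_compat, Rmult_le_compat_r; [lra | ]; nra. }
replace (Re a + 2) with (Re a + 1 + 1) by ring; rewrite !gamma_dom_S by auto; unfold gamma_dom.
pose proof (weber_weight_bound M t) as HW; fold E in HW.
replace (M * t) with (m * Rabs x * t + m * t) in HW by (unfold M; ring); rewrite exp_plus in HW.
set (e1 := exp (m * Rabs x * t)) in *; set (e2 := exp (m * t)) in *.
set (e3 := exp (- t ^ 2 / 2)) in *; set (p := Rpower t (Re a - 1)) in *.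
assert (He1 : 0 < e1) by apply exp_pos. assert (He2 : 0 < e2) by apply exp_pos.
assert (He3 : 0 < e3) by apply exp_pos. assert (Hp : 0 < p) by apply exp_pos.
apply Rle_trans with ((m * Rabs d * t) ^ 2 * e2 * (e1 * e3 * p)).
- apply Rmult_le_compat; try apply Cmod_ge_0; auto.
  eapply Rle_trans; [ exact H2 | ].
  apply Rmult_le_compat_l; auto; apply pow2_ge_0.
- replace ((m * Rabs d * t) ^ 2) with (m ^ 2 * d ^ 2 * t ^ 2) by (rewrite !Rpow_mult_distr, pow2_abs; ring).
  replace (_ * e2 * _) with (m ^ 2 * d ^ 2 * t ^ 2 * p * (e1 * e2 * e3)) by ring.
  replace (m ^ 2 * E * d ^ 2 * _) with (m ^ 2 * d ^ 2 * t ^ 2 * p * (E * exp (- t))) by ring.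
  apply Rmult_le_compat_l; auto.
  apply Rmult_le_pos; [ | lra]; apply Rmult_le_pos; [apply Rmult_le_pos | ]; apply pow2_ge_0.
Qed.

Lemma is_CInt_half_square (f : R -> C) (l : C) :
  (forall t, 0 < t -> @continuous R_UniformSpace CN f t) ->
  is_CInt f l -> is_CInt (fun t => RtoC t * f (t * t / 2)%R)%C l.
Proof.
intros Hf H P HP; specialize (H P HP); unfold filtermapi in *.
assert (Hm : filterlim (fun ab : R * R => (fst ab * fst ab / 2, snd ab * snd ab / 2))
  (filter_prod (at_right 0) (Rbar_locally p_infty)) (filter_prod (at_right 0) (Rbar_locally p_infty))).
{ apply filterlim_pair.
  - apply (filterlim_comp _ _ _ fst (fun a => a * a / 2) _ (at_right 0)).
    + apply filterlim_fst.
    + intros Q [eps HQ]; exists (mkposreal _ (Rmin_glb_lt _ _ _ Rlt_0_1 (cond_pos eps))).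
      intros a Ha Ha0; change (Rabs (a - 0) < Rmin 1 eps) in Ha; apply HQ; [ | nra].
      change (Rabs (a * a / 2 - 0) < eps).
      pose proof (Rmin_l 1 eps); pose proof (Rmin_r 1 eps).
      rewrite Rminus_0_r, Rabs_pos_eq in * by nra; nra.
  - apply (filterlim_comp _ _ _ snd (fun a => a * a / 2) _ (Rbar_locally p_infty)).
    + apply filterlim_snd.
    + intros Q [B HQ]; exists (2 + Rabs B); intros b Hb; apply HQ.
      pose proof (Rabs_pos B); pose proof (Rle_abs B); nra. }
specialize (Hm _ H); unfold filtermap in Hm.
assert (Hp : filter_prod (at_right 0) (Rbar_locally p_infty) (fun ab => 0 < fst ab /\ fst ab < snd ab)).
{ apply filter_prod_0_infty; simpl; auto. }
generalize (filter_and _ _ Hm Hp); apply filter_imp; intros [a b]; simpl.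
intros [[z [Hz HPz]] [Ha Hb]]; exists z; split; auto.
assert (Hc := @is_RInt_comp CV f (fun t => t * t / 2) (fun t => t) a b).
cbv beta in Hc; rewrite (@is_RInt_unique CV f _ _ z Hz) in Hc.
eapply is_RInt_ext; [ | apply Hc].
- intros t Ht; simpl; apply scal_RtoC.
- intros t; rewrite Rmin_left, Rmax_right by lra; intros Ht; apply Hf; nra.
- intros t _; split; [ | apply continuous_id].
  auto_derive; auto; field.
Qed.

(** At [z = 0] the substitution of [t^2/2] turns Weber's integral into Euler's. *)
Lemma weber_int_0 (a : C) : 0 < Re a -> weber_int a 0 = (cpowR 2 (a / 2 - 1) * Gamma_int (a / 2))%C.
Proof.
intros Ha.
assert (Ha2 : 0 < Re (a / 2)) by (unfold Re in *; simpl; lra).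
pose proof (is_CInt_half_square _ _ (continuous_gamma_integrand (a / 2)) (is_CInt_Gamma _ Ha2)) as H.
apply (is_CInt_scal (cpowR 2 (a / 2 - 1))) in H.
rewrite <- (is_CInt_unique _ _ H); symmetry.
apply is_CInt_unique; eapply is_CInt_ext; [ | apply is_CInt_weber_int, Ha].
intros t Ht; unfold weber_integrand, gamma_integrand.
replace (- 0 * RtoC t)%C with (RtoC 0) by ring; rewrite cexp_0.
replace (- t ^ 2 / 2) with (- (t * t / 2)) by field.
assert (E : (cpowR 2 (a / 2 - 1) * cpowR (t * t / 2) (a / 2 - 1) * RtoC t)%C = cpowR t (a - 1)).
{ rewrite <- (cpowR_1 t) by auto; unfold cpowR; rewrite <- !cexp_plus; f_equal.
  rewrite ln_div, ln_mult by nra.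
  rewrite RtoC_minus, RtoC_plus; field; apply RtoC_neq_0; lra. }
rewrite <- E; ring.
Qed.

(** * The outgoing function w *)

(* Equal to [(a - 1) * weber_int (a - 1) z] when [Re a > 1]; this form continues the parabolic
   cylinder function to [Re a > 0], so both branches of [PCD] are covered at once. *)
Definition weber_comb (a z : C) : C := (z * weber_int a z + weber_int (a + 1) z)%C.

Lemma is_derive_C_ext (f g : R -> C) (x : R) (l : C) : (forall t, f t = g t) ->
  @is_derive R_AbsRing CN f x l -> @is_derive R_AbsRing CN g x l.
Proof. apply (@is_derive_ext R_AbsRing CN). Qed.

Lemma is_derive_line (c : C) (x : R) : @is_derive R_AbsRing CN (fun x => c * RtoC x)%C x c.
Proof.
eapply is_derive_C_eq.
- apply is_derive_C_scal, (is_derive_RtoC (fun t => t)), is_derive_id.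
- change (@one R_AbsRing) with 1; ring.
Qed.

(** By [weber_int_rec] all terms but one cancel. That the derivative is a single Weber integral
    gives both the second-order equation and the decay used for the flux. *)
Lemma is_derive_weber_comb (a c : C) (x : R) : 0 < Re a ->
  @is_derive R_AbsRing CN (fun x => weber_comb a (c * RtoC x)) x (- c * (a - 1) * weber_int a (c * RtoC x))%C.
Proof.
intros Ha; unfold weber_comb; eapply is_derive_C_eq.
- apply (is_derive_C_plus (fun x => (c * RtoC x) * weber_int a (c * RtoC x))%C (fun x => weber_int (a + 1) (c * RtoC x))).
  + apply (is_derive_C_mult (fun x => c * RtoC x)%C (fun x => weber_int a (c * RtoC x))).
    * apply is_derive_line.
    * now apply is_derive_weber_int.
  + apply is_derive_weber_int; unfold Re in *; simpl; lra.
- replace (a + 1 + 1)%C with (a + 2)%C by ring; rewrite weber_int_rec by auto; ring.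
Qed.

(** For [Re a > 0] this is [Gamma(a) D_{1-a}(c x)], by [PCD_eq]. *)
Definition weber_sol (c a : C) (x : R) : C := (cexp (- ((c * RtoC x) * (c * RtoC x)) / 4) * weber_comb a (c * RtoC x))%C.

Definition weber_sol' (c a : C) (x : R) : C :=
  (cexp (- ((c * RtoC x) * (c * RtoC x)) / 4) *
   (- c * (a - 1) * weber_int a (c * RtoC x) - c * c * RtoC x / 2 * weber_comb a (c * RtoC x)))%C.

Lemma is_derive_gauss (c : C) (x : R) :
  @is_derive R_AbsRing CN (fun x => cexp (- ((c * RtoC x) * (c * RtoC x)) / 4)%C) x
    (- (c * c * RtoC x / 2) * cexp (- ((c * RtoC x) * (c * RtoC x)) / 4))%C.
Proof.
apply (is_derive_cexp (fun x => - ((c * RtoC x) * (c * RtoC x)) / 4)%C).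
apply (is_derive_C_ext (fun x => - (/ 4) * ((c * RtoC x) * (c * RtoC x)))%C).
- intros t; unfold Cdiv; ring.
- eapply is_derive_C_eq.
  + apply is_derive_C_scal, (is_derive_C_mult (fun x => c * RtoC x)%C (fun x => c * RtoC x)%C);
    apply is_derive_line.
  + field; split; apply RtoC_neq_0; lra.
Qed.

Lemma is_derive_weber_sol (c a : C) (x : R) : 0 < Re a ->
  @is_derive R_AbsRing CN (weber_sol c a) x (weber_sol' c a x).
Proof.
intros Ha; eapply is_derive_C_eq.
- apply (is_derive_C_mult (fun x => cexp (- ((c * RtoC x) * (c * RtoC x)) / 4)%C) (fun x => weber_comb a (c * RtoC x))).
  + apply is_derive_gauss.
  + now apply is_derive_weber_comb.
- unfold weber_sol'; field; apply RtoC_neq_0; lra.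
Qed.

Lemma is_derive_weber_sol' (c a : C) (x : R) : 0 < Re a ->
  @is_derive R_AbsRing CN (weber_sol' c a) x
    ((c * c * (c * c) * RtoC (x * x) / 4 + c * c * (a - 3 / 2)) * weber_sol c a x)%C.
Proof.
intros Ha; eapply is_derive_C_eq.
- apply (is_derive_C_mult (fun x => cexp (- ((c * RtoC x) * (c * RtoC x)) / 4)%C)
    (fun x => - c * (a - 1) * weber_int a (c * RtoC x) - c * c * RtoC x / 2 * weber_comb a (c * RtoC x))%C).
  + apply is_derive_gauss.
  + apply (is_derive_C_ext (fun x => (- c * (a - 1)) * weber_int a (c * RtoC x) +
       ((- (c * c) / 2) * RtoC x) * weber_comb a (c * RtoC x))%C).
    * intros t; field; apply RtoC_neq_0; lra.
    * apply is_derive_C_plus; [ apply is_derive_C_scal; now apply is_derive_weber_int | ].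
      apply (is_derive_C_mult (fun x => (- (c * c) / 2) * RtoC x)%C (fun x => weber_comb a (c * RtoC x))).
      -- apply is_derive_line.
      -- now apply is_derive_weber_comb.
- unfold weber_sol, weber_comb; rewrite RtoC_mult; field; apply RtoC_neq_0; lra.
Qed.

Lemma weber_sol_0 (c a : C) : weber_sol c a 0 = weber_int (a + 1) 0.
Proof.
unfold weber_sol, weber_comb; rewrite !Cmult_0_r, Cmult_0_l.
replace (- 0 / 4)%C with (RtoC 0) by (field; apply RtoC_neq_0; lra); rewrite cexp_0; ring.
Qed.

Lemma weber_sol'_0 (c a : C) : weber_sol' c a 0 = (- c * (a - 1) * weber_int a 0)%C.
Proof.
unfold weber_sol'; rewrite !Cmult_0_r.
replace (- 0 / 4)%C with (RtoC 0) by (field; apply RtoC_neq_0; lra); rewrite cexp_0.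
field; apply RtoC_neq_0; lra.
Qed.

Lemma Gamma_fuel_int (n : nat) (z : C) : 0 < Re z -> Gamma_fuel n z = Gamma_int z.
Proof. intros H; destruct n; cbn [Gamma_fuel]; destruct (Rlt_dec 0 (Re z)); easy. Qed.

Lemma CGamma_int (z : C) : 0 < Re z -> CGamma z = Gamma_int z.
Proof. apply Gamma_fuel_int. Qed.

Lemma CGamma_strip (z : C) : - 1 < Re z -> z <> 0%C -> CGamma z = (Gamma_int (z + 1) / z)%C.
Proof.
intros H Hz; destruct (Rlt_dec 0 (Re z)) as [H0 | H0].
- rewrite CGamma_int, Gamma_int_S by auto; field; auto.
- unfold CGamma; cbn [Gamma_fuel]; destruct (Rlt_dec 0 (Re z)); [contradiction | ].
  rewrite Gamma_fuel_int; auto; unfold Re in *; simpl; lra.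
Qed.

Lemma D_fuel_int (n : nat) (nu z : C) : Re nu < 0 -> D_fuel n nu z = D_int nu z.
Proof. intros H; destruct n; cbn [D_fuel]; destruct (Rlt_dec (Re nu) 0); easy. Qed.

Lemma D_int_weber_int (nu z : C) :
  D_int nu z = (cexp (- (z * z) / 4) / CGamma (- nu) * weber_int (- nu) z)%C.
Proof. reflexivity. Qed.

Lemma PCD_eq (a z : C) : 0 < Re a ->
  PCD (1 - a) z = (cexp (- (z * z) / 4) / Gamma_int a * weber_comb a z)%C.
Proof.
intros Ha; unfold PCD.
assert (HG : Gamma_int a <> 0%C) by now apply Gamma_int_neq_0.
destruct (Rlt_dec (Re (1 - a)) 0) as [H | H].
- rewrite D_fuel_int, D_int_weber_int by auto.
  assert (H1 : 0 < Re (a - 1)) by (unfold Re in *; simpl in *; lra).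
  replace (- (1 - a))%C with (a - 1)%C by ring.
  rewrite CGamma_int by auto.
  assert (HG1 : Gamma_int (a - 1) <> 0%C) by now apply Gamma_int_neq_0.
  assert (Ha1 : (a - 1)%C <> 0%C) by (intros E; rewrite E in H1; simpl in H1; lra).
  assert (E1 : Gamma_int a = ((a - 1) * Gamma_int (a - 1))%C).
  { rewrite <- Gamma_int_S by auto; f_equal; ring. }
  assert (E2 : weber_int (a + 1) z = ((a - 1) * weber_int (a - 1) z - z * weber_int a z)%C).
  { replace (a + 1)%C with (a - 1 + 2)%C by ring; rewrite weber_int_rec by auto.
    replace (a - 1 + 1)%C with a by ring; reflexivity. }
  unfold weber_comb; rewrite E1, E2; field; auto.
(* Here [0 <= Re (1 - a) < 1], so a single recurrence step brings both recursive calls into the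
   range of the integral. *)
- assert (Hup : up (Re (1 - a)) = 1%Z).
  { symmetry; apply tech_up; unfold Re in *; simpl in *; lra. }
  rewrite Hup.
  assert (H1 : Re (1 - a - 1) < 0) by (unfold Re in *; simpl in *; lra).
  assert (H2 : Re (1 - a - 2) < 0) by (unfold Re in *; simpl in *; lra).
  cbn [D_fuel]; destruct (Rlt_dec (Re (1 - a)) 0); [contradiction | ].
  rewrite !D_fuel_int, !D_int_weber_int by auto.
  replace (- (1 - a - 1))%C with a by ring.
  replace (- (1 - a - 2))%C with (a + 1)%C by ring.
  rewrite !CGamma_int by (unfold Re in *; simpl in *; lra).
  rewrite Gamma_int_S by auto.
  unfold weber_comb; field; split; auto; intros E; rewrite E in Ha; simpl in Ha; lra.
Qed.

(** Its square is [-ih], so the Gaussian factor of [weber_sol] has modulus one along this ray, while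
    its positive real part makes the Weber integral decay. *)
Definition ray (h : R) : C := (cis (- (PI / 4)) * RtoC (sqrt h))%C.

Lemma ray_eq (h : R) : ray h = (cexp (- (Defs.Ci * RtoC (PI / 4))) * RtoC (sqrt h))%C.
Proof.
unfold ray, cis; do 2 f_equal; apply injective_projections; simpl; ring.
Qed.

Lemma ray_sqr (h : R) : 0 < h -> (ray h * ray h)%C = (0, - h).
Proof.
intros Hh; unfold ray.
replace (_ * _)%C with (cis (- (PI / 4)) * cis (- (PI / 4)) * RtoC (sqrt h * sqrt h))%C
  by (rewrite RtoC_mult; ring).
rewrite <- cis_plus, sqrt_sqrt by lra.
replace (- (PI / 4) + - (PI / 4)) with (- (PI / 2)) by field.
unfold cis, cexp, Re, Im; simpl; rewrite exp_0, cos_neg, sin_neg, cos_PI2, sin_PI2.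
apply injective_projections; simpl; ring.
Qed.

(** The [a] for which the order [i lambda - 1/2] equals [1 - a]. *)
Definition weber_index (h kappa sigma : R) : C := (3 / 2 - sigma, kappa / h).

Lemma w_fun_eq (h kappa sigma x : R) : 0 < h -> sigma < 3 / 2 ->
  w_fun h (lam_of h kappa sigma) x =
  (/ Gamma_int (weber_index h kappa sigma) * weber_sol (ray h) (weber_index h kappa sigma) x)%C.
Proof.
intros Hh Hs; unfold w_fun.
replace (Defs.Ci * lam_of h kappa sigma - RtoC (1 / 2))%C with (1 - weber_index h kappa sigma)%C.
2:{ unfold lam_of, weber_index; apply injective_projections; simpl; field; lra. }
rewrite PCD_eq by (simpl; lra).
unfold weber_sol; rewrite ray_eq; unfold Cdiv; ring.
Qed.

Lemma A_fun_eq (h kappa sigma : R) : 0 < h -> kappa <> 0 -> sigma < 1 ->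
  A_fun (lam_of h kappa sigma) =
  (cis (- (PI / 4)) * RtoC (sqrt 2) * Gamma_quot (kappa / (2 * h)) (1 / 4 - sigma / 2))%C.
Proof.
intros Hh Hk Hs; unfold A_fun, Gamma_quot.
set (s := 1 / 4 - sigma / 2); set (y := kappa / (2 * h)).
assert (Hy : y <> 0) by (unfold y; apply Rmult_integral_contrapositive_currified; auto; apply Rinv_neq_0_compat; lra).
replace (RtoC (3 / 4) - Defs.Ci * lam_of h kappa sigma / 2)%C with ((s + 1 / 2)%R, y).
2:{ unfold lam_of, s, y; apply injective_projections; simpl; field; lra. }
replace (RtoC (1 / 4) - Defs.Ci * lam_of h kappa sigma / 2)%C with ((s, y) : C).
2:{ unfold lam_of, s, y; apply injective_projections; simpl; field; lra. }
assert (Hsy : ((s, y) : C) <> 0%C) by (intros E; injection E; auto).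
rewrite CGamma_int, CGamma_strip by (auto; unfold s; simpl; lra).
replace ((s, y) + 1)%C with ((s + 1)%R, y) by (apply injective_projections; simpl; ring).
replace (cis (- (PI / 4))) with (cexp (- (Defs.Ci * RtoC (PI / 4)))).
2:{ unfold cis; f_equal; apply injective_projections; simpl; ring. }
field; split; auto; apply Gamma_int_neq_0; unfold s; simpl; lra.
Qed.

Lemma weber_sol_0_neq_0 (c a : C) : - 1 < Re a -> weber_sol c a 0 <> 0%C.
Proof.
intros Ha; rewrite weber_sol_0, weber_int_0 by (unfold Re in *; simpl; lra).
apply Cmult_neq_0; [ apply cexp_neq_0 | ].
apply Gamma_int_neq_0; unfold Re in *; simpl; lra.
Qed.

(** At 0 the logarithmic derivative is [-c (a-1)] times the ratio of the Weber integrals of indices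
    [a] and [a + 1]. By [weber_int_0] with [a = 2s + 1 + 2iy] this is [-c sqrt 2 Gamma_quot], the
    [sqrt 2] arising from [a - 1 = 2 (s + iy)] and a ratio [2^{-1/2}] of powers of two. *)
Lemma weber_sol'_0_eq (h kappa sigma : R) : 0 < h -> kappa <> 0 -> sigma < 1 ->
  weber_sol' (ray h) (weber_index h kappa sigma) 0 =
  (- RtoC (sqrt h) * A_fun (lam_of h kappa sigma) * weber_sol (ray h) (weber_index h kappa sigma) 0)%C.
Proof.
intros Hh Hk Hs; rewrite A_fun_eq, weber_sol_0, weber_sol'_0 by auto.
rewrite !weber_int_0 by (simpl; lra).
set (s := 1 / 4 - sigma / 2); set (y := kappa / (2 * h)).
assert (Ea : weber_index h kappa sigma = ((2 * s + 1)%R, (2 * y)%R)).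
{ unfold weber_index, s, y; apply injective_projections; simpl; field; lra. }
rewrite Ea; unfold Gamma_quot.
replace (((2 * s + 1)%R, (2 * y)%R) / 2)%C with ((s + 1 / 2)%R, y)
  by (apply injective_projections; simpl; field).
replace ((((2 * s + 1)%R, (2 * y)%R) + 1) / 2)%C with ((s + 1)%R, y)
  by (apply injective_projections; simpl; field).
replace (((2 * s + 1)%R, (2 * y)%R) - 1)%C with (2 * (s, y))%C
  by (apply injective_projections; simpl; ring).
replace (((s + 1)%R, y) - 1)%C with ((((s + 1 / 2)%R, y) - 1) + RtoC (1 / 2))%C
  by (apply injective_projections; simpl; field).
rewrite cpowR_plus, cpowR_RtoC, <- (Rpower_sqrt 2) by lra.
replace (1 / 2) with (/ 2) by field.
assert (E2 : (RtoC (Rpower 2 (/ 2)) * RtoC (Rpower 2 (/ 2)))%C = RtoC 2).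
{ rewrite <- RtoC_mult, <- Rpower_plus; replace (/ 2 + / 2) with 1 by field; rewrite Rpower_1; auto; lra. }
unfold ray; rewrite <- E2; field.
apply Gamma_int_neq_0; unfold s; simpl; lra.
Qed.

(** * Positivity of the flux *)

Lemma is_derive_R_ext (f g : R -> R) (x l : R) :
  (forall t, f t = g t) -> is_derive f x l -> is_derive g x l.
Proof. apply (@is_derive_ext R_AbsRing R_NormedModule). Qed.

Lemma is_derive_nondecr (g g' : R -> R) (x1 x2 : R) : x1 <= x2 ->
  (forall t, x1 <= t <= x2 -> is_derive g t (g' t)) ->
  (forall t, x1 <= t <= x2 -> 0 <= g' t) -> g x1 <= g x2.
Proof.
intros [Hx | ->] Hd Hp; [ | lra].
destruct (MVT_cor2 g g' x1 x2 Hx) as [t [Ht Hin]].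
- intros t Ht; now apply is_derive_Reals, Hd.
- pose proof (Hp t ltac:(lra)); nra.
Qed.

Lemma weber_sol_ode (h kappa sigma x : R) : 0 < h -> sigma < 3 / 2 ->
  @is_derive R_AbsRing CN (weber_sol' (ray h) (weber_index h kappa sigma)) x
    ((RtoC kappa + Defs.Ci * RtoC (h * sigma) - RtoC (h ^ 2 * x ^ 2 / 4))
     * weber_sol (ray h) (weber_index h kappa sigma) x)%C.
Proof.
intros Hh Hs; eapply is_derive_C_eq; [ apply is_derive_weber_sol'; simpl; lra | ].
f_equal; rewrite ray_sqr by auto.
unfold weber_index; apply injective_projections; simpl; field; lra.
Qed.

Section Flux.
Variables (h : R) (hh : 0 < h) (u v u1 v1 : R -> R).
Let q (x : R) : R := 1 - h ^ 2 * x ^ 2 / 4.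
Hypothesis Hu : forall x, is_derive u x (u1 x).
Hypothesis Hv : forall x, is_derive v x (v1 x).
Hypothesis Hu1 : forall x, is_derive u1 x (q x * u x).
Hypothesis Hv1 : forall x, is_derive v1 x (q x * v x).
(** The outgoing condition enters this section only through [HB]: the energy decays at points where
    the flux is nonpositive. *)
Variable B : R.
Hypothesis HB : forall x, 0 < x -> v1 x * u x - u1 x * v x <= 0 ->
  u1 x ^ 2 + v1 x ^ 2 - q x * (u x ^ 2 + v x ^ 2) <= B / x ^ 2.

Lemma is_derive_R_sqr (f : R -> R) (x a : R) :
  is_derive f x a -> is_derive (fun t => f t ^ 2) x (2 * a * f x).
Proof.
intros H; apply (is_derive_R_ext (fun t => f t * f t)); [intros; simpl; ring | ].
replace (2 * a * f x) with (a * f x + f x * a) by ring; now apply is_derive_R_mult.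
Qed.

Lemma flux_const (x : R) : 0 <= x -> v1 x * u x - u1 x * v x = v1 0 * u 0 - u1 0 * v 0.
Proof.
intros Hx.
assert (Hd : forall t, is_derive (fun x => v1 x * u x - u1 x * v x) t 0).
{ intros t.
  replace 0 with ((q t * v t * u t + v1 t * u1 t) - (q t * u t * v t + u1 t * v1 t)) by ring.
  apply is_derive_R_minus; apply is_derive_R_mult; auto. }
destruct Hx as [Hx | <-]; [ | reflexivity].
destruct (MVT_cor2 (fun x => v1 x * u x - u1 x * v x) (fun _ => 0) 0 x Hx) as [t [Ht _]].
- intros t _; now apply is_derive_Reals.
- lra.
Qed.

Lemma energy_nondecr (x1 x2 : R) : 0 <= x1 <= x2 ->
  u1 x1 ^ 2 + v1 x1 ^ 2 - q x1 * (u x1 ^ 2 + v x1 ^ 2) <=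
  u1 x2 ^ 2 + v1 x2 ^ 2 - q x2 * (u x2 ^ 2 + v x2 ^ 2).
Proof.
intros Hx.
apply (is_derive_nondecr (fun x => u1 x ^ 2 + v1 x ^ 2 - q x * (u x ^ 2 + v x ^ 2))
  (fun x => h ^ 2 * x / 2 * (u x ^ 2 + v x ^ 2))); try lra.
- intros t _.
  assert (Hq : is_derive q t (- (h ^ 2 * t / 2))) by (unfold q; auto_derive; auto; field).
  replace (h ^ 2 * t / 2 * (u t ^ 2 + v t ^ 2)) with
    ((2 * (q t * u t) * u1 t + 2 * (q t * v t) * v1 t) -
     (- (h ^ 2 * t / 2) * (u t ^ 2 + v t ^ 2) + q t * (2 * u1 t * u t + 2 * v1 t * v t))) by ring.
  apply is_derive_R_minus; [ | apply (is_derive_R_mult q (fun x => u x ^ 2 + v x ^ 2)); auto];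
    apply is_derive_R_plus; now apply is_derive_R_sqr.
- intros t Ht.
  assert (0 <= u t ^ 2 + v t ^ 2) by (pose proof (pow2_ge_0 (u t)); pose proof (pow2_ge_0 (v t)); lra).
  apply Rmult_le_pos; auto.
  assert (0 <= h ^ 2 * t) by (apply Rmult_le_pos; [apply pow2_ge_0 | lra]); lra.
Qed.

(** Backward uniqueness in Gronwall form: the squared data [N] satisfy [|N'| <= L N] on [[0, x0]],
    because [L] bounds [|1 + q|] there; hence [e^{Lx} N] is nondecreasing. *)
Lemma zero_data_backward (x0 : R) : 0 <= x0 ->
  u x0 ^ 2 + v x0 ^ 2 + (u1 x0 ^ 2 + v1 x0 ^ 2) = 0 -> u 0 = 0 /\ v 0 = 0.
Proof.
intros Hx0 H0.
set (L := 2 + h ^ 2 * x0 ^ 2 / 4).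
set (N := fun x => u x ^ 2 + v x ^ 2 + (u1 x ^ 2 + v1 x ^ 2)).
assert (Hm : exp (L * 0) * N 0 <= exp (L * x0) * N x0).
{ apply (is_derive_nondecr (fun x => exp (L * x) * N x)
    (fun x => exp (L * x) * (L * N x + 2 * (1 + q x) * (u x * u1 x + v x * v1 x)))); auto.
  - intros t _.
    replace (exp (L * t) * (L * N t + 2 * (1 + q t) * (u t * u1 t + v t * v1 t))) with
      (L * exp (L * t) * N t + exp (L * t) *
       ((2 * u1 t * u t + 2 * v1 t * v t) + (2 * (q t * u t) * u1 t + 2 * (q t * v t) * v1 t))) by ring.
    apply (is_derive_R_mult (fun x => exp (L * x)) N).
    + auto_derive; auto; ring.
    + unfold N; apply is_derive_R_plus; apply is_derive_R_plus; now apply is_derive_R_sqr.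
  - intros t Ht; apply Rmult_le_pos; [left; apply exp_pos | ].
    assert (Hq : Rabs (1 + q t) <= L).
    { assert (0 <= h ^ 2 * t ^ 2 <= h ^ 2 * x0 ^ 2).
      { split; [apply Rmult_le_pos; apply pow2_ge_0 | ].
        apply Rmult_le_compat_l; [apply pow2_ge_0 | apply pow_incr; lra]. }
      apply Rabs_le; unfold q, L; lra. }
    apply Rabs_le_between in Hq.
    assert (Hs : Rabs (2 * (u t * u1 t + v t * v1 t)) <= N t).
    { unfold N; apply Rabs_le; split.
      - pose proof (pow2_ge_0 (u t + u1 t)); pose proof (pow2_ge_0 (v t + v1 t)); nra.
      - pose proof (pow2_ge_0 (u t - u1 t)); pose proof (pow2_ge_0 (v t - v1 t)); nra. }
    apply Rabs_le_between in Hs.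
    set (k := 1 + q t) in *; set (m := u t * u1 t + v t * v1 t) in *; set (n := N t) in *.
    assert (0 <= n) by lra. assert (0 <= L) by lra.
    destruct (Rle_lt_dec 0 k); nra. }
fold (N x0) in H0; rewrite H0, Rmult_0_r, Rmult_0_r, exp_0 in Hm.
unfold N in Hm.
pose proof (pow2_ge_0 (u 0)); pose proof (pow2_ge_0 (v 0)).
pose proof (pow2_ge_0 (u1 0)); pose proof (pow2_ge_0 (v1 0)).
split; apply Rsqr_0_uniq; unfold Rsqr; simpl in *; lra.
Qed.

(* A solution with nonpositive flux would have energy tending to 0 at infinity;
   as the energy is nondecreasing, the solution would vanish. *)
Lemma flux_pos : (u 0 <> 0 \/ v 0 <> 0) -> 0 < v1 0 * u 0 - u1 0 * v 0.
Proof.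
intros Hnz; apply Rnot_le_lt; intros Hle.
(* There [q = -3], so the energy is a positive definite form and its nonpositivity annihilates all
   data. *)
set (x0 := 4 / h).
assert (Hx0 : 0 < x0) by (apply Rdiv_lt_0_compat; lra).
assert (Hq0 : q x0 = - 3) by (unfold q, x0; field; lra).
assert (HE : u1 x0 ^ 2 + v1 x0 ^ 2 - q x0 * (u x0 ^ 2 + v x0 ^ 2) <= 0).
{ apply Rnot_lt_le; intros Hlt.
  set (e := u1 x0 ^ 2 + v1 x0 ^ 2 - q x0 * (u x0 ^ 2 + v x0 ^ 2)) in *.
  (* Chosen so that [e X^2 > B], which contradicts the decay bound. *)
  set (X := x0 + Rabs B / e + 1).
  assert (HX0 : 0 <= Rabs B / e) by (apply Rmult_le_pos; [apply Rabs_pos | left; now apply Rinv_0_lt_compat]).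
  assert (HX : x0 <= X) by (unfold X; lra).
  pose proof (energy_nondecr x0 X ltac:(lra)) as H1; fold e in H1.
  assert (H2 : v1 X * u X - u1 X * v X <= 0) by (rewrite flux_const by lra; auto).
  pose proof (HB X ltac:(lra) H2) as H3.
  assert (H4 : e <= B / X ^ 2) by lra.
  apply (Rmult_le_compat_r (X ^ 2)) in H4; [ | apply pow2_ge_0].
  replace (B / X ^ 2 * X ^ 2) with B in H4 by (field; lra).
  assert (H6 : e * X <= e * X ^ 2) by (apply Rmult_le_compat_l; [lra | unfold X in *; nra]).
  assert (H5 : e * X = e * x0 + Rabs B + e) by (unfold X; field; lra).
  pose proof (Rle_abs B); nra. }
rewrite Hq0 in HE.
pose proof (pow2_ge_0 (u x0)); pose proof (pow2_ge_0 (v x0)).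
pose proof (pow2_ge_0 (u1 x0)); pose proof (pow2_ge_0 (v1 x0)).
destruct (zero_data_backward x0) as [Z1 Z2]; [lra | lra | ].
destruct Hnz; auto.
Qed.

End Flux.

(** On the ray [|e^{-zt}| = e^{-rxt} <= 1/(rxt)]; the factor [1/t] costs one moment, hence
    [1 < Re a]. *)
Lemma Cmod_weber_int_decay (h x : R) (a : C) : 0 < h -> 0 < x -> 1 < Re a ->
  Cmod (weber_int a (ray h * RtoC x)) <= exp (1 / 2) * rGamma (Re a - 1) / (sqrt h * cos (PI / 4)) / x.
Proof.
intros Hh Hx Ha.
set (r := sqrt h * cos (PI / 4)).
assert (Hr : 0 < r).
{ apply Rmult_lt_0_compat; [now apply sqrt_lt_R0 | ].
  pose proof PI_RGT_0; apply cos_gt_0; lra. }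
assert (Hc : Re (ray h) = r).
{ unfold ray, cis, cexp, Re, Im, r; simpl; rewrite exp_0, cos_neg; ring. }
replace (exp (1 / 2) * rGamma (Re a - 1) / r / x) with (exp (1 / 2) / r / x * rGamma (Re a - 1))
  by (field; lra).
apply (Cmod_CInt_le (weber_integrand a (ray h * RtoC x)) (fun t => exp (1 / 2) / r / x * gamma_dom (Re a - 1) t)).
- intros t Ht; unfold weber_integrand, gamma_dom.
  rewrite !Cmod_mult, Cmod_cexp, Cmod_R, Rabs_pos_eq, Cmod_cpowR by (left; apply exp_pos).
  replace (Re (a - 1)) with (Re a - 1 - 1 + 1) by (unfold Re; simpl; ring).
  rewrite Rpower_plus, Rpower_1 by auto.
  replace (Re (- (ray h * RtoC x) * RtoC t)) with (- (r * x * t)).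
  2:{ rewrite <- Hc; unfold Re; simpl; ring. }
  set (w := r * x * t).
  assert (Hw : 0 < w) by (unfold w; apply Rmult_lt_0_compat; [apply Rmult_lt_0_compat | ]; auto).
  assert (H1 : exp (- w) * w <= 1).
  { rewrite exp_Ropp; apply (Rmult_le_reg_l (exp w)); [apply exp_pos | ].
    pose proof (exp_ineq1_le w); pose proof (exp_pos w).
    replace (exp w * (/ exp w * w)) with w by (field; lra); lra. }
  pose proof (weber_weight_bound 0 t) as H2.
  replace ((0 + 1) ^ 2 / 2) with (1 / 2) in H2 by field.
  rewrite Rmult_0_l, exp_0, Rmult_1_l in H2.
  set (p := Rpower t (Re a - 1 - 1)); assert (Hp : 0 < p) by apply exp_pos.
  apply (Rmult_le_reg_r (r * x)); [now apply Rmult_lt_0_compat | ].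
  replace (exp (1 / 2) / r / x * (p * exp (- t)) * (r * x)) with (exp (1 / 2) * exp (- t) * p) by (field; lra).
  replace (_ * _) with (exp (- w) * w * exp (- t ^ 2 / 2) * p) by (unfold w; ring).
  apply Rmult_le_compat_r; [lra | ].
  pose proof (exp_pos (- t ^ 2 / 2)); nra.
- apply is_CInt_weber_int; lra.
- apply is_RInt0_scal, is_RInt0_rGamma; lra.
Qed.

(** With [f = p + iq] and [f1 = p1 + iq1] the hypothesis gives [k |f|^2 <= |f| |f1|] by
    Cauchy-Schwarz. *)
Lemma flux_algebra (k p q p1 q1 : R) : 0 < k ->
  q1 * p - p1 * q + k * (p ^ 2 + q ^ 2) <= 0 -> k ^ 2 * (p ^ 2 + q ^ 2) <= p1 ^ 2 + q1 ^ 2.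
Proof.
intros Hk H.
set (S := p ^ 2 + q ^ 2) in *; set (T := p1 ^ 2 + q1 ^ 2).
assert (HS : 0 <= S) by (unfold S; nra).
assert (HT : 0 <= T) by (unfold T; nra).
set (m := p1 * q - q1 * p).
assert (Hm : m * m <= S * T).
{ assert (0 <= (p * p1 + q * q1) ^ 2) by apply pow2_ge_0; unfold m, S, T; nra. }
assert (HkS : k * S <= m) by (unfold m; lra).
assert (H2 : (k * S) * (k * S) <= m * m) by (apply Rmult_le_compat; nra).
destruct HS as [HS | <-]; [ | lra].
apply (Rmult_le_reg_r S); auto; nra.
Qed.

Lemma Im_A_fun_neg (h : R) : 0 < h -> Im (A_fun (lam_of h 1 0)) < 0.
Proof.
intros Hh.
set (c := ray h); set (a := weber_index h 1 0).
assert (Ha : 0 < Re a) by (simpl; lra).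
assert (H1 : forall x, @is_derive R_AbsRing CN (weber_sol c a) x (weber_sol' c a x)) by (intros; now apply is_derive_weber_sol).
assert (H2 : forall x, @is_derive R_AbsRing CN (weber_sol' c a) x (RtoC (1 - h ^ 2 * x ^ 2 / 4) * weber_sol c a x)%C).
{ intros x; eapply is_derive_C_eq; [apply weber_sol_ode; lra | ].
  fold c a; f_equal; apply injective_projections; simpl; ring. }
set (D := exp (1 / 2) * rGamma (Re a - 1) / (sqrt h * cos (PI / 4))).
(* With [S = |f|^2] and [T = |f1|^2] the energy is at most [2T + 2k^2 S + k^2 S], and [k^2 S <= T];
   hence the 5. *)
set (B := 5 * (Cmod (c * (a - 1)) * D) ^ 2).
assert (HP : 0 < snd (weber_sol' c a 0) * fst (weber_sol c a 0) - fst (weber_sol' c a 0) * snd (weber_sol c a 0)).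
{ apply (flux_pos h Hh (fun x => fst (weber_sol c a x)) (fun x => snd (weber_sol c a x))
    (fun x => fst (weber_sol' c a x)) (fun x => snd (weber_sol' c a x))) with (B := B).
  - intros x; now apply is_derive_C_fst.
  - intros x; now apply is_derive_C_snd.
  - intros x; replace (_ * _) with (fst (RtoC (1 - h ^ 2 * x ^ 2 / 4) * weber_sol c a x)%C) by (simpl; ring).
    now apply is_derive_C_fst.
  - intros x; replace (_ * _) with (snd (RtoC (1 - h ^ 2 * x ^ 2 / 4) * weber_sol c a x)%C) by (simpl; ring).
    now apply is_derive_C_snd.
  - intros x Hx Hfl.
    pose proof (Cmod_weber_int_decay h x a Hh Hx ltac:(simpl; lra)) as HJ; fold c D in HJ.
    set (f := weber_comb a (c * RtoC x)); set (f1 := (- c * (a - 1) * weber_int a (c * RtoC x))%C).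
    set (E := cexp (- ((c * RtoC x) * (c * RtoC x)) / 4)).
    set (k := h * x / 2).
    assert (Ec : (c * c)%C = (0, - h)) by now apply ray_sqr.
    assert (EW : weber_sol c a x = (E * f)%C) by reflexivity.
    (* [E] has modulus one, and differentiating it gives the factor [ik] with [k = hx/2]. So the
       flux is [Im(f1 conj f) + k |f|^2], and its nonpositivity bounds [f] by the decaying [f1]. *)
    assert (EW' : weber_sol' c a x = (E * (f1 + (0, k) * f))%C).
    { unfold weber_sol'; fold E f f1; rewrite Ec; unfold k.
      f_equal; unfold Cminus; f_equal.
      apply injective_projections; simpl; field. }
    assert (HE : fst E * fst E + snd E * snd E = 1).
    { assert (Hm : Cmod E = 1).
      { unfold E; rewrite Cmod_cexp.
        replace (- (c * RtoC x * (c * RtoC x)) / 4)%C with (- ((c * c) * RtoC (x * x)) / 4)%C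
          by (rewrite RtoC_mult; field; apply RtoC_neq_0; lra).
        rewrite Ec; etransitivity; [ | apply exp_0]; f_equal; unfold Re; simpl; field. }
      pose proof (Cmod2_alt E) as H; rewrite Hm in H; unfold Re, Im in H; clear - H; clearbody E; lra. }
    assert (HT : fst f1 ^ 2 + snd f1 ^ 2 <= (Cmod (c * (a - 1)) * D / x) ^ 2).
    { pose proof (Cmod2_alt f1) as H; unfold Re, Im in H; rewrite <- H.
      apply pow_incr; split; [apply Cmod_ge_0 | ].
      unfold f1; replace (- c * (a - 1) * weber_int a (c * RtoC x))%C with (- (c * (a - 1) * weber_int a (c * RtoC x)))%C by ring.
      rewrite Cmod_opp, (Cmod_mult (c * (a - 1))).
      replace (Cmod (c * (a - 1)) * D / x) with (Cmod (c * (a - 1)) * (D / x)) by (field; lra).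
      apply Rmult_le_compat_l; [apply Cmod_ge_0 | exact HJ]. }
    replace (B / x ^ 2) with (5 * (Cmod (c * (a - 1)) * D / x) ^ 2) by (unfold B; field; lra).
    rewrite EW, EW' in *; clear EW EW' HJ.
    clearbody f f1 E.
    destruct f as [p q], f1 as [p1 q1], E as [e1 e2]; simpl fst in *; simpl snd in *.
    set (S := p ^ 2 + q ^ 2); set (T := p1 ^ 2 + q1 ^ 2) in *.
    assert (Hk : 0 < k) by (unfold k; nra).
    assert (Hf2 : q1 * p - p1 * q + k * S <= 0).
    { replace (q1 * p - p1 * q + k * S) with ((e1 * e1 + e2 * e2) * (q1 * p - p1 * q + k * S))
        by (rewrite HE; ring).
      eapply Rle_trans; [ | exact Hfl]; right; unfold S; ring. }
    assert (Hk2 : k ^ 2 * S <= T) by (apply flux_algebra with (1 := Hk) (2 := Hf2)).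
    replace (_ + _ - _) with ((e1 * e1 + e2 * e2) *
      ((p1 - k * q) ^ 2 + (q1 + k * p) ^ 2 - (1 - h ^ 2 * x ^ 2 / 4) * S)) by (unfold S; ring).
    rewrite HE.
    replace (1 - h ^ 2 * x ^ 2 / 4) with (1 - k ^ 2) by (unfold k; field).
    assert (0 <= S) by (unfold S; nra).
    assert ((p1 - k * q) ^ 2 + (q1 + k * p) ^ 2 <= 2 * T + 2 * (k ^ 2 * S)).
    { unfold S, T; pose proof (pow2_ge_0 (p1 + k * q)); pose proof (pow2_ge_0 (q1 - k * p)); nra. }
    nra.
  - destruct (Req_dec (fst (weber_sol c a 0)) 0) as [E1 | ]; auto.
    destruct (Req_dec (snd (weber_sol c a 0)) 0) as [E2 | ]; auto.
    exfalso; apply (weber_sol_0_neq_0 c a); [lra | now apply injective_projections]. }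
unfold c, a in HP; rewrite weber_sol'_0_eq in HP by lra; fold c a in HP.
set (A := A_fun (lam_of h 1 0)) in *; set (w := weber_sol c a 0) in *.
assert (Hs : 0 < sqrt h) by now apply sqrt_lt_R0.
replace (_ - _) with (- (sqrt h * (fst w * fst w + snd w * snd w)) * Im A) in HP
  by (unfold Im; simpl; ring).
assert (0 <= sqrt h * (fst w * fst w + snd w * snd w)) by nra.
apply Rnot_le_lt; intros HA; nra.
Qed.

(** * Outgoing solutions *)

Lemma Gamma_int_conj (z : C) : 0 < Re z -> Gamma_int (Cconj z) = Cconj (Gamma_int z).
Proof.
intros Hz; apply is_CInt_unique.
pose proof (is_CInt_Gamma z Hz) as H.
apply (is_CInt_ext (fun t => Cconj (gamma_integrand z t))).
- intros t Ht; unfold gamma_integrand, cpowR, cexp, Re, Im; simpl.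
  rewrite !Rmult_0_r, !Rminus_0_r, !Rplus_0_l.
  apply injective_projections; simpl; unfold Re, Im; simpl.
  + replace ((- snd z + - 0) * ln t) with (- ((snd z + - 0) * ln t)) by ring.
    rewrite cos_neg, sin_neg; ring.
  + replace ((- snd z + - 0) * ln t) with (- ((snd z + - 0) * ln t)) by ring.
    rewrite cos_neg, sin_neg; ring.
- apply is_CInt_intro.
  + exact (is_CInt_fst _ _ H).
  + exact (@is_RInt_gen_opp R_NormedModule _ _ filter_0 filter_infty _ _ (is_CInt_snd _ _ H)).
Qed.

(** Passing from [kappa = 1] to [kappa = -1] only changes the sign of [y]. *)
Lemma Gamma_quot_opp (y s : R) : 0 < y -> - (1 / 2) < s -> Gamma_quot (- y) s = Cconj (Gamma_quot y s).
Proof.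
intros Hy Hs; unfold Gamma_quot.
assert (HG : Gamma_int (s + 1, y) <> 0%C) by (apply Gamma_int_neq_0; simpl; lra).
rewrite Cdiv_conj, Cmult_conj, <- !Gamma_int_conj by (auto; simpl; lra); reflexivity.
Qed.

Lemma cis_eq (t : R) : cis t = (cos t, sin t).
Proof. unfold cis, cexp, Re, Im; simpl; rewrite exp_0, !Rmult_1_l; reflexivity. Qed.

Lemma A_fun_polar (h sigma : R) : 0 < h -> sigma < 1 ->
  exists r, 0 < r /\
    A_fun (lam_of h 1 sigma) = (RtoC r * cis (theta (1 / (2 * h)) (1 / 4 - sigma / 2) - PI / 4))%C /\
    A_fun (lam_of h (-1) sigma) = (RtoC r * cis (- theta (1 / (2 * h)) (1 / 4 - sigma / 2) - PI / 4))%C.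
Proof.
intros Hh Hs.
set (y := 1 / (2 * h)); assert (Hy : 0 < y) by (apply Rdiv_lt_0_compat; lra).
set (s := 1 / 4 - sigma / 2); assert (Hs' : - (1 / 2) < s) by (unfold s; lra).
destruct (Gamma_quot_polar y Hy s Hs') as [rho [Hr E]].
assert (H2 : 0 < sqrt 2) by (apply sqrt_lt_R0; lra).
exists (sqrt 2 * rho); split; [now apply Rmult_lt_0_compat | split].
- rewrite A_fun_eq by lra; fold y s; rewrite E.
  unfold Rminus; rewrite cis_plus, RtoC_mult; ring.
- rewrite A_fun_eq by lra; replace (-1 / (2 * h)) with (- y) by (unfold y; field; lra); fold s.
  rewrite Gamma_quot_opp, E by auto.
  unfold Rminus; rewrite cis_plus, RtoC_mult, Cmult_conj.
  replace (Cconj (cis (theta y s))) with (cis (- theta y s)).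
  + replace (Cconj (RtoC rho)) with (RtoC rho) by (apply injective_projections; simpl; ring); ring.
  + rewrite !cis_eq, cos_neg, sin_neg; reflexivity.
Qed.

Lemma real_pos_cis (r t : R) : 0 < r ->
  (real_pos (RtoC r * cis t) <-> sin t = 0 /\ 0 < cos t).
Proof.
intros Hr; rewrite cis_eq; unfold real_pos, Re, Im; simpl.
replace (r * sin t + 0 * cos t) with (r * sin t) by ring.
replace (r * cos t - 0 * sin t) with (r * cos t) by ring.
split; intros [H1 H2]; split; try nra.
Qed.

Lemma sin_zero_centered (t : R) : - PI < t < PI -> sin t = 0 -> t = 0.
Proof.
intros Ht H; destruct (Rtotal_order t 0) as [H0 | [ | H0]]; auto; exfalso.
- pose proof (sin_gt_0 (- t) ltac:(lra) ltac:(lra)) as Hs; rewrite sin_neg in Hs; lra.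
- pose proof (sin_gt_0 t ltac:(lra) ltac:(lra)); lra.
Qed.

Lemma real_pos_A_iff (h sigma : R) : 0 < h -> sigma < 1 ->
  (real_pos (A_fun (lam_of h 1 sigma)) <-> theta (1 / (2 * h)) (1 / 4 - sigma / 2) = PI / 4).
Proof.
intros Hh Hs; destruct (A_fun_polar h sigma Hh Hs) as [r [Hr [-> _]]].
assert (Hy : 0 < 1 / (2 * h)) by (apply Rdiv_lt_0_compat; lra).
rewrite real_pos_cis by auto.
set (t := theta _ _).
assert (Ht : 0 < t < PI) by (split; [now apply theta_pos | now apply theta_lt_PI]).
split.
- intros [H _]; pose proof (sin_zero_centered (t - PI / 4) ltac:(lra) H); lra.
- intros ->; rewrite Rminus_diag, sin_0, cos_0; lra.
Qed.

Lemma not_real_pos_A_neg (h sigma : R) : 0 < h -> sigma < 1 ->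
  ~ real_pos (A_fun (lam_of h (-1) sigma)).
Proof.
intros Hh Hs; destruct (A_fun_polar h sigma Hh Hs) as [r [Hr [_ ->]]].
assert (Hy : 0 < 1 / (2 * h)) by (apply Rdiv_lt_0_compat; lra).
rewrite real_pos_cis by auto.
set (t := theta _ _).
assert (Ht : 0 < t < PI) by (split; [now apply theta_pos | now apply theta_lt_PI]).
(* The only multiple of [pi] in the range of the angle is [-pi]; recentred there, the sine condition
   forces the cosine to be -1. *)
replace (- t - PI / 4) with (- (t - 3 * (PI / 4) + PI)) by field.
rewrite sin_neg, cos_neg, neg_sin, neg_cos; intros [H1 H2].
assert (H0 : sin (t - 3 * (PI / 4)) = 0) by lra.
apply sin_zero_centered in H0; [ | lra].
rewrite H0, cos_0 in H2; lra.
Qed.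

(** The value [s = 1/4] is [sigma = 0], where the flux gives [Im A < 0], that is,
    [sin (theta - pi/4) < 0]. *)
Lemma theta_right_lt (h : R) : 0 < h -> theta (1 / (2 * h)) (1 / 4) < PI / 4.
Proof.
intros Hh; pose proof (Im_A_fun_neg h Hh) as H.
destruct (A_fun_polar h 0 Hh ltac:(lra)) as [r [Hr [E _]]]; rewrite E in H.
replace (1 / 4 - 0 / 2) with (1 / 4) in H by field.
assert (Hy : 0 < 1 / (2 * h)) by (apply Rdiv_lt_0_compat; lra).
set (t := theta _ _) in *.
assert (Ht : 0 < t < PI) by (split; [now apply theta_pos | now apply theta_lt_PI]).
apply Rnot_le_lt; intros Hle.
pose proof (sin_ge_0 (t - PI / 4) ltac:(lra) ltac:(lra)).
rewrite cis_eq in H; unfold Im in H; simpl in H; nra.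
Qed.

Lemma is_derive_quotient (f : R -> C) (l : C) (eps : R) : 0 < eps ->
  @is_derive R_AbsRing CN f 0 l ->
  locally 0 (fun t => t <> 0 -> Cmod ((f t - f 0) / RtoC t - l) < eps).
Proof.
intros He [_ H].
assert (He2 : 0 < eps / 2) by lra.
specialize (H 0 (fun P HP => HP) (mkposreal _ He2)).
revert H; apply filter_imp; intros t Ht Hne.
rewrite norm_Cmod, scal_RtoC in Ht.
change (Cmod (f t - f 0 - RtoC (t - 0) * l) <= eps / 2 * Rabs (t - 0)) in Ht.
rewrite Rminus_0_r in Ht.
assert (Ht0 : RtoC t <> 0%C) by now apply RtoC_neq_0.
replace ((f t - f 0) / RtoC t - l)%C with ((f t - f 0 - RtoC t * l) / RtoC t)%C by (field; auto).
rewrite Cmod_div, Cmod_R by auto.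
pose proof (Rabs_pos_lt t Hne).
apply Rle_lt_trans with (eps / 2); [ | lra].
apply (Rmult_le_reg_r (Rabs t)); auto.
replace (_ / Rabs t * Rabs t) with (Cmod (f t - f 0 - RtoC t * l)) by (field; lra); auto.
Qed.

Lemma filterlim_quotient_right (f g : R -> C) (l : C) :
  @is_derive R_AbsRing CN f 0 l -> g 0 = f 0 -> (forall t, 0 < t -> g t = f t) ->
  filterlim (fun t => (g t - g 0) / RtoC t)%C (at_right 0) (locally l).
Proof.
intros H H0 Hg; apply (filterlim_Cmod _ (FF := filter_0)); intros eps He.
pose proof (is_derive_quotient f l eps He H) as Hq; unfold at_right, within.
revert Hq; apply filter_imp; intros t Ht Hpos.
rewrite H0, Hg by auto; apply Ht; lra.
Qed.

Lemma filterlim_quotient_left (f g : R -> C) (l : C) :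
  @is_derive R_AbsRing CN f 0 l -> g 0 = f 0 -> (forall t, t < 0 -> g t = f t) ->
  filterlim (fun t => (g t - g 0) / RtoC t)%C (at_left 0) (locally l).
Proof.
intros H H0 Hg; apply (filterlim_Cmod _ (FF := filter_filter)); intros eps He.
pose proof (is_derive_quotient f l eps He H) as Hq; unfold at_left, within.
revert Hq; apply filter_imp; intros t Ht Hneg.
rewrite H0, Hg by auto; apply Ht; lra.
Qed.

Lemma is_derive_C_opp_arg (f : R -> C) (x : R) (l : C) :
  @is_derive R_AbsRing CN f (- x) l -> @is_derive R_AbsRing CN (fun t => f (- t)) x (- l)%C.
Proof.
intros H; eapply is_derive_C_eq.
- apply (@is_derive_comp R_AbsRing CN f Ropp x l (-1) H).
  auto_derive; auto.
- rewrite scal_RtoC; ring.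
Qed.

Section Outgoing.
Variables (p h kappa sigma : R).
Hypotheses (hp : 1 < p) (hh : 0 < h) (hk : kappa <> 0) (hs : sigma < 1).
Let w : R -> C := w_fun h (lam_of h kappa sigma).
Let w' (x : R) : C := (/ Gamma_int (weber_index h kappa sigma) * weber_sol' (ray h) (weber_index h kappa sigma) x)%C.
Let A : C := A_fun (lam_of h kappa sigma).

Lemma is_derive_w (x : R) : @is_derive R_AbsRing CN w x (w' x).
Proof.
apply (is_derive_C_ext (fun x => / Gamma_int (weber_index h kappa sigma) * weber_sol (ray h) (weber_index h kappa sigma) x)%C).
- intros t; unfold w; rewrite w_fun_eq by lra; reflexivity.
- apply is_derive_C_scal, is_derive_weber_sol; simpl; lra.
Qed.

Lemma is_derive_w' (x : R) : @is_derive R_AbsRing CN w' x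
  ((RtoC kappa + Defs.Ci * RtoC (h * sigma) - RtoC (h ^ 2 * x ^ 2 / 4)) * w x)%C.
Proof.
eapply is_derive_C_eq.
- apply is_derive_C_scal, weber_sol_ode; lra.
- unfold w; rewrite w_fun_eq by lra; ring.
Qed.

Lemma w_0_neq_0 : w 0 <> 0%C.
Proof.
unfold w; rewrite w_fun_eq by lra; apply Cmult_neq_0.
- apply Cinv_neq_0, Gamma_int_neq_0; simpl; lra.
- apply weber_sol_0_neq_0; simpl; lra.
Qed.

Lemma w'_0 : w' 0 = (- RtoC (sqrt h) * A * w 0)%C.
Proof.
unfold w', w; rewrite w_fun_eq, weber_sol'_0_eq by lra; fold A; ring.
Qed.

Lemma outgoing_of_real_pos : real_pos A ->
  exists phi, outgoing_solution p h kappa sigma phi /\ nontrivial phi.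
Proof.
intros [HI HR].
assert (EA : A = RtoC (Re A)) by (apply injective_projections; auto).
assert (Hsq : 0 < sqrt h) by now apply sqrt_lt_R0.
assert (Hw0 : 0 < Cmod (w 0)) by apply Cmod_gt_0, w_0_neq_0.
set (m := 2 * sqrt h * Re A).
assert (Hm : 0 < m) by (unfold m; nra).
(* The amplitude solves [(r |w(0)|)^(p-1) = 2 sqrt h A], the jump condition for the even function
   [r w(|x|)]. *)
set (r := Rpower m (/ (p - 1)) / Cmod (w 0)).
assert (Hr : 0 < r) by (apply Rdiv_lt_0_compat; auto; apply exp_pos).
set (f := fun x => (RtoC r * w x)%C); set (f' := fun x => (RtoC r * w' x)%C).
assert (Hf : forall x, @is_derive R_AbsRing CN f x (f' x)) by (intros; apply is_derive_C_scal, is_derive_w).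
assert (Hfn : forall x, @is_derive R_AbsRing CN (fun t => f (- t)) x (- f' (- x)%R)%C)
  by (intros; now apply is_derive_C_opp_arg).
set (q := fun x => (RtoC kappa + Defs.Ci * RtoC (h * sigma) - RtoC (h ^ 2 * x ^ 2 / 4))%C).
assert (Hf' : forall x, @is_derive R_AbsRing CN f' x (q x * f x)%C).
{ intros x; eapply is_derive_C_eq; [ apply is_derive_C_scal, is_derive_w' | unfold f, q; ring]. }
set (phi := fun x => f (Rabs x)).
assert (Hpos : forall x, 0 < x -> locally x (fun t => 0 < t)) by (intros x Hx; apply (open_gt 0 x Hx)).
assert (Hneg : forall x, x < 0 -> locally x (fun t => t < 0)) by (intros x Hx; apply (open_lt 0 x Hx)).
assert (Hphi0 : phi 0 = f 0) by (unfold phi; now rewrite Rabs_R0).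
assert (Hphip : forall x, 0 < x -> phi x = f x) by (intros; unfold phi; now rewrite Rabs_pos_eq by lra).
assert (Hphin : forall x, x < 0 -> phi x = f (- x)) by (intros; unfold phi; now rewrite Rabs_left).
exists phi; split; [split; [ | split; [ | split]] | ].
- exists (fun x => if Rlt_dec 0 x then f' x else (- f' (- x)%R)%C), (fun x => (q x * phi x)%C).
  intros z Hz; split; [ | split].
  + destruct (Rlt_dec 0 z) as [H | H].
    * apply (@is_derive_ext_loc R_AbsRing CN f); auto.
      generalize (Hpos z H); apply filter_imp; intros t Ht; symmetry; auto.
    * assert (H' : z < 0) by lra.
      apply (@is_derive_ext_loc R_AbsRing CN (fun t => f (- t))); auto.
      generalize (Hneg z H'); apply filter_imp; intros t Ht; symmetry; auto.
  + destruct (Rlt_dec 0 z) as [H | H].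
    * rewrite Hphip by auto; apply (@is_derive_ext_loc R_AbsRing CN f'); auto.
      generalize (Hpos z H); apply filter_imp; intros t Ht; destruct (Rlt_dec 0 t); [auto | contradiction].
    * assert (H' : z < 0) by lra.
      rewrite Hphin by auto.
      apply (@is_derive_ext_loc R_AbsRing CN (fun t => - (1) * f' (- t)%R)%C).
      -- generalize (Hneg z H'); apply filter_imp; intros t Ht; destruct (Rlt_dec 0 t); [lra | ].
         change ((- (1) * f' (- t)%R)%C = (- f' (- t)%R)%C); ring.
      -- eapply is_derive_C_eq.
         ++ apply is_derive_C_scal, is_derive_C_opp_arg, Hf'.
         ++ unfold q; replace ((- z) ^ 2) with (z ^ 2) by ring; ring.
  + unfold q; ring.
- rewrite Hphi0; unfold phi; rewrite <- (Rabs_R0) at 2.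
  apply (continuous_comp Rabs f); [apply continuous_Rabs | ].
  eapply is_derive_C_continuous; apply Hf.
- exists (f' 0), (- f' 0)%C; split; [ | split].
  + apply (filterlim_quotient_right f); auto.
  + apply (filterlim_quotient_left (fun t => f (- t)) phi (- f' 0)%C); [ | | exact Hphin].
    * rewrite <- Ropp_0 at 2; apply Hfn.
    * rewrite Hphi0, Ropp_0; reflexivity.
  + assert (E : Rpower (Cmod (phi 0)) (p - 1) = m).
    { rewrite Hphi0; unfold f; rewrite Cmod_mult, Cmod_R, Rabs_pos_eq by lra.
      unfold r; replace (_ / _ * _) with (Rpower m (/ (p - 1))) by (field; lra).
      rewrite Rpower_mult, Rinv_l, Rpower_1; lra. }
    rewrite E, Hphi0; unfold f', f; rewrite w'_0, EA.
    unfold m; rewrite !RtoC_mult; ring.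
- exists (RtoC r), (RtoC r); split; [exact Hphip | exact Hphin].
- exists 0; rewrite Hphi0; apply Cmult_neq_0; [apply RtoC_neq_0; lra | apply w_0_neq_0].
Qed.

Lemma real_pos_of_outgoing (phi : R -> C) :
  outgoing_solution p h kappa sigma phi -> nontrivial phi -> real_pos A.
Proof.
intros [_ [Hc [[dp [dm [Hdp [Hdm Hj]]]] [ap [am [Hp Hm]]]]]] Hnt.
fold w in Hp, Hm.
assert (PR : ProperFilter' (at_right 0)) by apply Proper_StrongProper, at_right_proper_filter.
assert (PL : ProperFilter' (at_left 0)) by apply Proper_StrongProper, at_left_proper_filter.
assert (Hfp : forall x, @is_derive R_AbsRing CN (fun x => ap * w x)%C x (ap * w' x)%C)
  by (intros; apply is_derive_C_scal, is_derive_w).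
assert (Hfm : @is_derive R_AbsRing CN (fun x => am * w (- x)%R)%C 0 (- (am * w' 0))%C).
{ apply (is_derive_C_opp_arg (fun x => am * w x)%C); rewrite Ropp_0; apply is_derive_C_scal, is_derive_w. }
(* The outgoing form says nothing at 0 itself; continuity recovers [phi 0] as the limit from either
   side. *)
assert (E0p : phi 0 = (ap * w 0)%C).
{ apply (@filterlim_locally_unique R R_AbsRing CN (at_right 0) PR phi).
  - apply (filterlim_filter_le_1 (F := locally 0)); auto; apply filter_le_within.
  - apply (filterlim_within_ext (fun t => 0 < t) (fun t => (ap * w t)%C)).
    + intros t Ht; symmetry; auto.
    + apply (filterlim_filter_le_1 (F := locally 0)); [apply filter_le_within | ].
      exact (is_derive_C_continuous _ _ _ (Hfp 0)). }
assert (E0m : phi 0 = (am * w 0)%C).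
{ apply (@filterlim_locally_unique R R_AbsRing CN (at_left 0) PL phi).
  - apply (filterlim_filter_le_1 (F := locally 0)); auto; apply filter_le_within.
  - apply (filterlim_within_ext (fun t => t < 0) (fun t => (am * w (- t)%R)%C)).
    + intros t Ht; symmetry; auto.
    + apply (filterlim_filter_le_1 (F := locally 0)); [apply filter_le_within | ].
      pose proof (is_derive_C_continuous _ _ _ Hfm) as H; unfold continuous in H.
      rewrite Ropp_0 in H; exact H. }
pose proof w_0_neq_0 as Hw.
assert (Eam : am = ap).
{ replace am with (am * w 0 / w 0)%C by (field; auto); rewrite <- E0m, E0p; field; auto. }
subst am.
assert (Edp : dp = (ap * w' 0)%C).
{ apply (@filterlim_locally_unique R R_AbsRing CN (at_right 0) PR _ _ _ Hdp).
  now apply (filterlim_quotient_right (fun x => ap * w x)%C). }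
assert (Edm : dm = (- (ap * w' 0))%C).
{ apply (@filterlim_locally_unique R R_AbsRing CN (at_left 0) PL _ _ _ Hdm).
  apply (filterlim_quotient_left (fun x => ap * w (- x)%R)%C); auto.
  now rewrite Ropp_0. }
assert (Hap : ap <> 0%C).
{ intros E; destruct Hnt as [z Hz]; apply Hz.
  destruct (Rtotal_order z 0) as [H | [-> | H]].
  - rewrite Hm, E by auto; ring.
  - rewrite E0p, E; ring.
  - rewrite Hp, E by auto; ring. }
set (P := Rpower (Cmod (phi 0)) (p - 1)) in *.
assert (HP : 0 < P) by apply exp_pos.
assert (Hsq : 0 < sqrt h) by now apply sqrt_lt_R0.
rewrite Edp, Edm, E0p, w'_0 in Hj.
assert (EA : A = RtoC (P / (2 * sqrt h))).
{ assert (Hs0 : RtoC (sqrt h) <> 0%C) by (apply RtoC_neq_0; lra).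
  assert (H2 : RtoC 2 <> 0%C) by (apply RtoC_neq_0; lra).
  unfold Rdiv; rewrite RtoC_mult, RtoC_inv, RtoC_mult by nra.
  transitivity (- (ap * (- RtoC (sqrt h) * A * w 0) - - (ap * (- RtoC (sqrt h) * A * w 0)))
     / (2 * RtoC (sqrt h) * (ap * w 0)))%C.
  - field; repeat split; auto.
  - rewrite Hj; field; repeat split; auto. }
rewrite EA; split; [reflexivity | ].
simpl; apply Rdiv_lt_0_compat; lra.
Qed.

End Outgoing.

Theorem theorem1p3 (p : R) (hp : 1 < p) :
  (* kappa = 1 *)
  (forall h : R, 0 < h ->
     exists sigma : R,
       (0 < sigma < 1 /\ real_pos (A_fun (lam_of h 1 sigma)) /\
        (forall sigma' : R, 0 < sigma' < 1 ->
           real_pos (A_fun (lam_of h 1 sigma')) -> sigma' = sigma)) /\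
       exists phi : R -> C, outgoing_solution p h 1 sigma phi /\ nontrivial phi) /\
  (* kappa = -1 *)
  (forall h sigma : R, 0 < h -> 0 < sigma < 1 ->
     ~ real_pos (A_fun (lam_of h (-1) sigma)) /\
     ~ (exists phi : R -> C, outgoing_solution p h (-1) sigma phi /\ nontrivial phi)).
Proof.
split.
- intros h Hh.
  assert (Hy : 0 < 1 / (2 * h)) by (apply Rdiv_lt_0_compat; lra).
  set (y := 1 / (2 * h)) in *.
  (* Inverting [s = 1/4 - sigma/2] gives the witness [sigma = 1/2 - 2s], and [-1/4 < s < 1/4]
     becomes [0 < sigma < 1]. *)
  destruct (theta_attains y Hy (PI / 4)) as [s [Hs Et]].
  { split; [now apply theta_right_lt | now apply theta_left_gt]. }
  assert (HA : real_pos (A_fun (lam_of h 1 (1 / 2 - 2 * s)))).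
  { apply real_pos_A_iff; try lra.
    rewrite <- Et; unfold y; f_equal; field. }
  exists (1 / 2 - 2 * s); split; [split; [lra | split; auto] | ].
  + intros s' Hs' HA'; apply real_pos_A_iff in HA'; try lra; fold y in HA'.
    destruct (Rtotal_order (1 / 4 - s' / 2) s) as [H | [H | H]]; [ | lra | ].
    * pose proof (theta_decr y Hy (1 / 4 - s' / 2) s ltac:(lra) H); lra.
    * pose proof (theta_decr y Hy s (1 / 4 - s' / 2) ltac:(lra) H); lra.
  + apply outgoing_of_real_pos; auto; lra.
- intros h sigma Hh Hs; split.
  + apply not_real_pos_A_neg; lra.
  + intros [phi [H1 H2]]; apply (not_real_pos_A_neg h sigma); try lra.
    apply (real_pos_of_outgoing p h (-1) sigma) with phi; auto; lra.
Qed.
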